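(* Let $\lambda\in\mathbb{C}$ and $|t|<1$. Then the multivariable hypergeometric function ${}^{(k)}E^{(r)}$ satisfies $$\sum_{n=0}^{\infty}\frac{(\lambda)_n}{n!}\,{}^{(k)}E^{(r)}\left(-n,\beta_{k+1},\dots,\beta_r;\gamma_1,\dots,\gamma_r;x_1,\dots,x_r\right)t^n$$ $$=(1-t)^{-\lambda}\,{}^{(k)}E^{(r)}\left(\lambda,\beta_{k+1},\dots,\beta_r;\gamma_1,\dots,\gamma_r;\frac{x_1(-t)^{\rho}}{(1-t)^{\rho}},\dots,\frac{x_k(-t)^{\rho}}{(1-t)^{\rho}},\frac{-x_{k+1}t}{1-t},\dots,\frac{-x_rt}{1-t}\right).$$
   Context: The Pochhammer symbol is $(\lambda)_\nu=\Gamma(\lambda+\nu)/\Gamma(\lambda)$ for $\lambda\in\mathbb{C}\setminus\{0,-1,-2,\dots\}$; moreover $(\lambda)_0=1$ and $(\lambda)_n=\lambda(\lambda+1)\cdots(\lambda+n-1)$ for every positive integer $n$ and every $\lambda\in\mathbb{C}$. (In particular, a symbol $(-n)_\nu$ with $n$ a nonnegative integer is defined only for nonnegative integers $\nu$.) Let $r\ge 1$ and $0\le k\le r$ be integers and $\rho\ge 0$. The multivariable hypergeometric function ${}^{(k)}E^{(r)}$ (depending on $\rho$) with complex parameters $\alpha,\beta_{k+1},\dots,\beta_r,\gamma_1,\dots,\gamma_r$ and complex variables $x_1,\dots,x_r$ is $${}^{(k)}E^{(r)}(\alpha,\beta_{k+1},\dots,\beta_r;\gamma_1,\dots,\gamma_r;x_1,\dots,x_r):=\sum_{m_1,\dots,m_r=0}^{\infty}(\alpha)_{\rho(m_1+\dots+m_k)+m_{k+1}+\dots+m_r}\frac{(\beta_{k+1})_{m_{k+1}}\cdots(\beta_r)_{m_r}}{(\gamma_1)_{m_1}\cdots(\gamma_r)_{m_r}}\frac{x_1^{m_1}}{m_1!}\cdots\frac{x_r^{m_r}}{m_r!},$$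 where $\rho(\sqrt{|x_1|}+\dots+\sqrt{|x_k|})+|x_{k+1}|+\dots+|x_r|<1$. Identities are understood for parameters and variables for which the functions occurring in them are defined (Pochhammer symbols defined, denominators nonzero, arguments satisfying this condition, defining series convergent). Powers of $1-t$ are principal.
   Formalization: The series over n on the left is assumed to converge at the given t; |t|<1 does not ensure this: for r=1, k=0, β=γ=λ=1, x=t=−0.9 it is the divergent Σ(−1.71)^n, although all functions are defined. *)

(* Defs.v *)
(* MathComp-Analysis world; complex numbers are R[i] over R : realType. *)
From HB Require Import structures.
From mathcomp Require Import all_boot all_order all_algebra.
From mathcomp Require Import finmap.
From mathcomp Require Import all_classical all_reals all_analysis.
From mathcomp Require Import complex.
From mathcomp.analysis.showcase Require Import summability.
Export numFieldNormedType.Exports.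

Set Implicit Arguments.
Unset Strict Implicit.
Unset Printing Implicit Defensive.

Import Order.TTheory GRing.Theory Num.Theory.
Local Open Scope classical_set_scope.
Local Open Scope ring_scope.
Local Open Scope complex_scope.

Section ComplexPowers.
Context {R : realType}.
Implicit Types z a : R[i].

Definition cexp z : R[i] :=
  (expR (complex.Re z))%:C * (cos (complex.Im z) +i* sin (complex.Im z)).

(* Principal argument, in ]-pi, pi]; only meaningful for z != 0. *)
Definition carg z : R :=
  let theta := acos (complex.Re z / Normc.normc z) in
  if 0 <= complex.Im z then theta else - theta.

Definition cln z : R[i] := ln (Normc.normc z) +i* carg z.

(* Principal power. It agrees with z ^+ n when a = n is a natural number, also
   at z = 0, since 0 ^ 0 = 1. *)
Definition cpow z a : R[i] :=
  if z == 0 then (a == 0)%:R else cexp (a * cln z).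

End ComplexPowers.

Section Pochhammer.
Context {R : realType}.
Implicit Types (z lambda : R[i]) (nu : R) (n : nat).

Definition nonpos_int z : Prop := exists n, z = - n%:R.

(* Gauss's limit formula; at the poles (nonpos_int z) the value is junk. *)
Definition Gamma z : R[i] :=
  limn ((fun n : nat =>
    n`!%:R * cpow n%:R z / \prod_(j < n.+1) (z + j%:R)) : nat -> R[i]^o).

Definition pochn lambda n : R[i] := \prod_(j < n) (lambda + j%:R).

(* For nu a natural number the product is used for every lambda; it equals the
   quotient of Gamma values whenever lambda is not a pole. *)
Definition pochhammer lambda nu : R[i] :=
  if nu \is a Num.nat then pochn lambda (Num.truncn nu)
  else Gamma (lambda + nu%:C) / Gamma lambda.

Definition pochhammer_defined lambda nu : Prop :=
  nu \is a Num.nat \/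
  (~ nonpos_int lambda /\ ~ nonpos_int (lambda + nu%:C)).

End Pochhammer.

(* Indices are 0-based: i < k stands for x_1, ..., x_k and k <= i for
   x_(k+1), ..., x_r. The family beta is indexed by all of 'I_r, but only its
   values at indices k <= i occur. *)
Section HypergeometricE.
Context {R : realType}.
Variables (rho : R) (k r : nat).
Implicit Types (alpha : R[i]) (beta gamma x : 'I_r -> R[i]).
Implicit Types m : {ffun 'I_r -> nat}.

Definition E_index m : R :=
  rho * (\sum_(i < r | (i < k)%N) m i)%:R
  + (\sum_(i < r | (k <= i)%N) m i)%:R.

Definition E_term alpha beta gamma x m : R[i] :=
  pochhammer alpha (E_index m)
  * ((\prod_(i < r | (k <= i)%N) pochn (beta i) (m i))
     / \prod_(i < r) pochn (gamma i) (m i))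
  * \prod_(i < r) (x i ^+ m i / (m i)`!%:R).

Definition E_region x : Prop :=
  rho * (\sum_(i < r | (i < k)%N) Num.sqrt (Normc.normc (x i)))
  + \sum_(i < r | (k <= i)%N) Normc.normc (x i) < 1.

(* The multiple series is summed unconditionally: limit of the partial sums
   over finite sets of multi-indices ordered by inclusion. *)
Definition E alpha beta gamma x : R[i] :=
  summability.sum (E_term alpha beta gamma x : _ -> R[i]^o).

Record E_defined alpha beta gamma x : Prop := EDefined {
  E_defined_pochhammer : forall m, pochhammer_defined alpha (E_index m);
  E_defined_denominator : forall i n, pochn (gamma i) n != 0;
  E_defined_region : E_region x;
  E_defined_convergent :
    cvg (partial_sum (E_term alpha beta gamma x : _ -> R[i]^o) @ totally)
}.

End HypergeometricE.

(* Main.v *)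
Require Import Defs.
From mathcomp Require Import all_boot all_order all_algebra finmap.
From mathcomp Require Import all_classical all_reals all_analysis.
From mathcomp Require Import complex ring lra.
From mathcomp.analysis.showcase Require Import summability.

(** The symbols (-n)_nu on the left exist only for natural nu, so rho is a
natural number p as soon as k >= 1, and each index E_index m is a natural number
N(m). Let c_m be the part of the term at m that does not depend on the first
parameter, d_N the sum of the c_m with N(m) = N, e_N = (lambda)_N d_N and
w = - t / (1 - t). Passing from x to y multiplies c_m by w ^ N(m). Since
(lambda)_n / n! (-n)_N = (-1)^N (lambda)_N (lambda + N)_(n - N) / (n - N)!,
grouping both sides by the value of N(m) leaves an identity about one sequence e
and one variable t, the Euler transform

  sum_n a_n t^n = (1 - t)^(- lambda) sum_N e_N w^N,
  a_n = sum_(N <= n) (-1)^N e_N (lambda + N)_(n - N) / (n - N)!.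

Expanding each (1 - t)^(- lambda - N) by the binomial series proves it when the
resulting double series converges absolutely, that is when |t| / (1 - |t|) lies
in the disc where f(w) = sum_N e_N w^N converges (euler_transform). At the given
t only the convergence of the two sides is known, and |t| / (1 - |t|) may well
be larger than |w|. The identity is therefore continued analytically along the
segment from 0 to t. The left side is a power series converging at t, hence
analytic at s t for 0 <= s < 1. The right side is analytic there too, because
|w(s t)| < |w(t)| for s < 1 and t nonzero (euler_map_ray_lt): the whole segment stays inside
the disc of f. Both sides agree near 0, so they agree on the half-open segment
(analytic_ray_identity). Letting s tend to 1, Abel's theorem (abel_limit) gives
the sum of the left series, and continuity of a power series on a closed disc of
absolute convergence gives the value of the right side; this is
euler_summation.

The binomial series is identified with the principal power in binomial_sum_cpow:
along the segment it satisfies the same differential equation as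
exp (- lambda log (1 - s t)).

All sums are unconditional (has_sum), except for the left series at t. The single lemma
has_sum_fiber, summation by fibres of a map, contains the Fubini theorems, the
Cauchy product and the grouping by degree. Analytic means locally the sum of a
power series (analytic_at).
*)

Set Implicit Arguments.
Unset Strict Implicit.

Import Order.TTheory GRing.Theory Num.Theory.
Local Open Scope classical_set_scope.
Local Open Scope ring_scope.
Local Open Scope complex_scope.

(** * The modulus of complex numbers *)

Section ComplexModulus.
Context {R : realType}.
Implicit Types z w : R[i].
Local Notation normc := (@Normc.normc R).

Lemma normc_ge0 z : 0 <= normc z.
Proof. by case: z => a b; exact: sqrtr_ge0. Qed.

Lemma normcD_le z w : normc (z + w) <= normc z + normc w.
Proof. exact: (@le_normcD R z w). Qed.

Lemma normc_opp z : normc (- z) = normc z.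
Proof. exact: (@normcN R z). Qed.

Lemma normcB_sym z w : normc (z - w) = normc (w - z).
Proof. by rewrite -normc_opp opprB. Qed.

Lemma normcB_le z w : normc (z - w) <= normc z + normc w.
Proof. by rewrite -(normc_opp w) normcD_le. Qed.

Lemma normcX z n : normc (z ^+ n) = normc z ^+ n.
Proof.
elim: n => [|n IH]; first by rewrite !expr0 Normc.normc1.
by rewrite !exprS Normc.normcM IH.
Qed.

Lemma normc_div z w : normc (z / w) = normc z / normc w.
Proof. by rewrite Normc.normcM Normc.normcV. Qed.

Lemma normc_eq0 z : (normc z == 0) = (z == 0).
Proof.
by apply/eqP/eqP => [/Normc.eq0_normc //|->]; exact: Normc.normc0.
Qed.

Lemma normc_gt0 z : (0 < normc z) = (z != 0).
Proof. by rewrite lt_def normc_ge0 andbT normc_eq0. Qed.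

Lemma normc_real (x : R) : normc x%:C = `|x|.
Proof. by rewrite /= expr0n /= addr0 sqrtr_sqr. Qed.

Lemma normc_nat n : normc n%:R = n%:R.
Proof.
have -> : (n%:R : R[i]) = (n%:R : R)%:C by rewrite rmorph_nat.
by rewrite normc_real ger0_norm.
Qed.

Lemma normc_sum_le (I : Type) (s : seq I) (P : pred I) (f : I -> R[i]) :
  normc (\sum_(i <- s | P i) f i) <= \sum_(i <- s | P i) normc (f i).
Proof.
elim/big_rec2: _ => [|i y x _ le_xy]; first by rewrite Normc.normc0.
by apply: le_trans (normcD_le _ _) _; rewrite lerD2l.
Qed.

Lemma normr_Re_le z : `|complex.Re z| <= normc z.
Proof. by have := normc_ge_Re z; rewrite lecR. Qed.

Lemma normr_Im_le z : `|complex.Im z| <= normc z.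
Proof.
case: z => a b /=; rewrite -(sqrtr_sqr b) ler_wsqrtr //.
by rewrite lerDr sqr_ge0.
Qed.

Lemma normc_le_ReIm z : normc z <= `|complex.Re z| + `|complex.Im z|.
Proof.
rewrite {1}(complexE z); apply: le_trans (normcD_le _ _) _.
by rewrite Normc.normcM !normc_real /= !expr0n /= add0r expr1n sqrtr1 mul1r.
Qed.

Lemma normc_small_eq0 z : (forall e, 0 < e -> normc z <= e) -> z = 0.
Proof.
move=> small; apply/Normc.eq0_normc/eqP; rewrite eq_le normc_ge0 andbT.
by apply/ler_addgt0Pr => e e0; rewrite add0r small.
Qed.

Lemma Re_sum (I : Type) (s : seq I) (P : pred I) (f : I -> R[i]) :
  complex.Re (\sum_(i <- s | P i) f i) = \sum_(i <- s | P i) complex.Re (f i).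
Proof. by elim/big_rec2: _ => // i x y _ <-; case: (f i) y => a b []. Qed.

Lemma Im_sum (I : Type) (s : seq I) (P : pred I) (f : I -> R[i]) :
  complex.Im (\sum_(i <- s | P i) f i) = \sum_(i <- s | P i) complex.Im (f i).
Proof. by elim/big_rec2: _ => // i x y _ <-; case: (f i) y => a b []. Qed.

End ComplexModulus.

(** * Unconditional sums of complex families *)

Lemma divr2_gt0 {R : realFieldType} (e : R) : 0 < e -> 0 < e / 2.
Proof. by move=> e0; rewrite divr_gt0. Qed.

Section UnconditionalSums.
Context {R : realType}.
Local Notation normc := (@Normc.normc R).
Local Open Scope fset_scope.
Local Open Scope ring_scope.

(** The limit along the finite index sets, written with the real modulus: an
elementary form of the convergence of partial sums that defines E. *)
Definition has_sum {I : choiceType} (f : I -> R[i]) (s : R[i]) : Prop :=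
  forall e : R, 0 < e -> exists A : {fset I}, forall B : {fset I},
    A `<=` B -> normc (\sum_(i <- B) f i - s) < e.

Definition abs_summable {I : choiceType} (f : I -> R[i]) : Prop :=
  exists M : R, forall A : {fset I}, \sum_(i <- A) normc (f i) <= M.

Section OneIndex.
Context {I : choiceType}.
Implicit Types (f g : I -> R[i]) (s t c : R[i]) (A B : {fset I}).

Lemma has_sum_unique f s t : has_sum f s -> has_sum f t -> s = t.
Proof.
move=> fs ft; apply/eqP; rewrite -subr_eq0; apply/eqP.
apply: normc_small_eq0 => e e0.
have [A hA] := fs _ (divr2_gt0 e0); have [B hB] := ft _ (divr2_gt0 e0).
have {}hA := hA (A `|` B) (fsubsetUl _ _); have {}hB := hB (A `|` B) (fsubsetUr _ _).
set S := \sum_(i <- _) _ in hA hB.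
have -> : s - t = (S - t) - (S - s) by ring.
apply: le_trans (normcB_le _ _) _.
by rewrite (splitr e); apply/ltW/ltrD; [exact: hB|exact: hA].
Qed.

Lemma has_sumZ f s c : has_sum f s -> has_sum (fun i => c * f i) (c * s).
Proof.
move=> fs e e0.
have c1 : 0 < normc c + 1 by rewrite ltr_wpDl ?normc_ge0.
have [A hA] := fs _ (divr_gt0 e0 c1); exists A => B AB.
rewrite -mulr_sumr -mulrBr Normc.normcM.
have := hA B AB; rewrite ltr_pdivlMr // mulrC; apply: le_lt_trans.
by rewrite ler_wpM2r ?normc_ge0 // lerDl.
Qed.

Lemma has_sumD f g s t :
  has_sum f s -> has_sum g t -> has_sum (fun i => f i + g i) (s + t).
Proof.
move=> fs gt e e0.
have [A hA] := fs _ (divr2_gt0 e0); have [B hB] := gt _ (divr2_gt0 e0).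
exists (A `|` B) => C; rewrite fsubUset => /andP[AC BC].
rewrite big_split /= opprD addrACA; apply: le_lt_trans (normcD_le _ _) _.
by rewrite (splitr e) ltrD ?hA ?hB.
Qed.

Lemma has_sumB f g s t :
  has_sum f s -> has_sum g t -> has_sum (fun i => f i - g i) (s - t).
Proof.
move=> fs gt; have := has_sumD fs (has_sumZ (-1) gt).
by rewrite mulN1r; under eq_fun do rewrite mulN1r.
Qed.

Lemma has_sum_finite f A :
  (forall i, i \notin A -> f i = 0) -> has_sum f (\sum_(i <- A) f i).
Proof.
move=> f0 e e0; exists A => B AB.
by rewrite -(big_fset_incl _ AB) ?subrr ?Normc.normc0 // => i _ /f0.
Qed.

Lemma has_sum_sum (K : Type) (r : seq K) (F : K -> I -> R[i]) (g : K -> R[i]) :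
  (forall k, has_sum (F k) (g k)) ->
  has_sum (fun i => \sum_(k <- r) F k i) (\sum_(k <- r) g k).
Proof.
move=> Fg; elim: r => [|k r IH].
  move=> e e0; exists fset0 => B _.
  by under eq_bigr do rewrite big_nil; rewrite big1 // big_nil subrr Normc.normc0.
rewrite big_cons; under eq_fun do rewrite big_cons; exact: has_sumD.
Qed.

Lemma abs_summable_le f g :
  (forall i, normc (f i) <= normc (g i)) -> abs_summable g -> abs_summable f.
Proof.
by move=> fg [M gM]; exists M => A; apply: le_trans (gM A); exact: ler_sum.
Qed.

Let real_family_has_sum (h : I -> R) (M : R) :
  (forall i, 0 <= h i) -> (forall A, \sum_(i <- A) h i <= M) ->
  exists s, has_sum (fun i => (h i)%:C) s.
Proof.
move=> h0 hM; pose E := [set \sum_(i <- A) h i | A in [set: {fset I}]].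
have supE : has_sup E.
  split; first by exists (\sum_(i <- fset0) h i); exists fset0.
  by exists M => _ [A _ <-].
exists (sup E)%:C => e e0; have [_ [A _ <-] ltA] := sup_adherent e0 supE.
exists A => B AB; rewrite -rmorph_sum -rmorphB normc_real /=.
have leB : \sum_(i <- B) h i <= sup E by apply: (sup_upper_bound supE); exists B.
have leAB : \sum_(i <- A) h i <= \sum_(i <- B) h i.
  rewrite (big_fsetID _ (fun i => i \in A) B) /=.
  have -> : [fset x in B | x \in A] = A.
    by apply/fsetP => i; rewrite !inE /= andbC; case: (boolP (i \in A)) => //= /(fsubsetP AB).
  by rewrite lerDl sumr_ge0.
rewrite ler0_norm ?subr_le0 // opprB ltrBlDr addrC -ltrBlDr.
exact: lt_le_trans leAB.
Qed.

(** Completeness is used only through suprema of nonnegative real families: a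
real h is the difference of the nonnegative families |h| + h and |h|, and a
complex family is treated by real and imaginary parts. *)
Lemma abs_summable_has_sum f : abs_summable f -> exists s, has_sum f s.
Proof.
move=> [M fM].
(* Real families dominated by |f| are summable. *)
have split_sum (h : I -> R) : (forall i, `|h i| <= normc (f i)) ->
    exists s, has_sum (fun i => (h i)%:C) s.
  move=> hf.
  have hM A : \sum_(i <- A) `|h i| <= M by apply: le_trans (fM A); exact: ler_sum.
  have [s sP] := real_family_has_sum (fun i => normr_ge0 (h i)) hM.
  have [u uP] : exists u, has_sum (fun i => (`|h i| + h i)%:C) u.
    apply: (@real_family_has_sum _ (M + M)) => [i|A].
      by have := ler_norm (- h i); rewrite normrN; lra.
    rewrite big_split lerD //; apply: le_trans (hM A); apply: ler_sum => i _.
    exact: ler_norm.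
  exists (u - s); have := has_sumB uP sP; congr has_sum.
  by apply/funext => i; rewrite -rmorphB addrAC subrr add0r.
have [u uP] := split_sum _ (fun i => normr_Re_le (f i)).
have [v vP] := split_sum _ (fun i => normr_Im_le (f i)).
exists (u + 'i * v); have := has_sumD uP (has_sumZ 'i vP).
by congr has_sum; apply/funext => i; rewrite -complexE.
Qed.

Let signed_bound (h : I -> R) A0 B :
  (forall C, [disjoint A0 & C] -> `|\sum_(i <- C) h i| <= 1) ->
  \sum_(i <- B) `|h i| <= 1 + 1 + \sum_(i <- A0) `|h i|.
Proof.
move=> hC; rewrite (big_fsetID _ (fun i => i \in A0) B) /= addrC lerD //; last first.
  have sub : [fset x in B | x \in A0] `<=` A0.
    by apply/fsubsetP => i; rewrite !inE => /andP[].
  rewrite [leRHS](big_fsetID _ (fun i => i \in B) A0) /=.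
  have -> : [fset x in A0 | x \in B] = [fset x in B | x \in A0].
    by apply/fsetP => i; rewrite !inE andbC.
  by rewrite lerDl sumr_ge0.
rewrite (big_fsetID _ (fun i => 0 <= h i)) /= lerD //.
  set C := [fset _ in _ | _]; have CP i : i \in C -> (i \notin A0) /\ 0 <= h i.
    by rewrite !inE => /andP[/andP[_ ->] ->].
  have dC : [disjoint A0 & C].
    by rewrite fdisjoint_sym; apply/fdisjointP => i /CP[].
  apply: le_trans (hC _ dC); apply: le_trans (ler_norm _).
  by rewrite le_eqVlt; apply/orP; left; apply/eqP/eq_big_seq => i /CP[_ /ger0_norm].
set C := [fset _ in _ | _]; have CP i : i \in C -> (i \notin A0) /\ h i < 0.
  by rewrite !inE -ltNge => /andP[/andP[_ ->] ->].
have dC : [disjoint A0 & C].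
  by rewrite fdisjoint_sym; apply/fdisjointP => i /CP[].
apply: le_trans (hC _ dC); rewrite -normrN; apply: le_trans (ler_norm _).
rewrite le_eqVlt; apply/orP; left; apply/eqP; rewrite -sumrN.
by apply: eq_big_seq => i /CP[_ /ltr0_norm].
Qed.

(** Unconditional convergence implies absolute convergence in finite dimension:
beyond some finite A0 all finite sums are bounded by 1, in particular those over
the indices where the real (or imaginary) part has a constant sign. *)
Lemma has_sum_abs_summable f s : has_sum f s -> abs_summable f.
Proof.
move=> fs; have [A0 hA] := fs (1 / 2) (divr2_gt0 ltr01).
have cauchy C : [disjoint A0 & C] -> normc (\sum_(i <- C) f i) <= 1.
  move=> dC; have h1 := hA _ (fsubset_refl A0); have h2 := hA _ (fsubsetUl A0 C).
  have E : \sum_(i <- A0 `|` C) f i = \sum_(i <- A0) f i + \sum_(i <- C) f i.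
    rewrite (big_fsetID _ (fun i => i \in A0)) /=; congr (_ + _); apply: eq_fbigl => i.
      by rewrite !inE andbC; case: (i \in A0).
    rewrite !inE; case: (boolP (i \in A0)) => /= iA.
      by apply/esym/negbTE; apply: (fdisjointP dC).
    by rewrite andbT.
  have -> : \sum_(i <- C) f i = (\sum_(i <- A0 `|` C) f i - s) - (\sum_(i <- A0) f i - s).
    by rewrite E; ring.
  by apply: le_trans (normcB_le _ _) _; apply: ltW; move: h1 h2; lra.
have bRe C : [disjoint A0 & C] -> `|\sum_(i <- C) complex.Re (f i)| <= 1.
  by move=> /cauchy; apply: le_trans; rewrite -Re_sum normr_Re_le.
have bIm C : [disjoint A0 & C] -> `|\sum_(i <- C) complex.Im (f i)| <= 1.
  by move=> /cauchy; apply: le_trans; rewrite -Im_sum normr_Im_le.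
eexists => B; apply: le_trans (ler_sum _ (fun i _ => normc_le_ReIm (f i))) _.
rewrite big_split /=; apply: lerD.
  exact: (signed_bound B bRe).
exact: (signed_bound B bIm).
Qed.

End OneIndex.

(** If a finite B contains enough indices and a finite K' contains their images,
the sum of g over K' is close to the sum of f over the part of B above K', which
again contains enough indices. Fubini, Cauchy products and grouping are all
instances. *)
Lemma has_sum_fiber {I K : choiceType} (f : I -> R[i]) (p : I -> K)
    (g : K -> R[i]) s :
  has_sum f s ->
  (forall k, has_sum (fun i => if p i == k then f i else 0) (g k)) ->
  has_sum g s.
Proof.
move=> fs gk e e0; have [A hA] := fs _ (divr2_gt0 e0).
exists (p @` A) => K' sub.
have [B [AB hB]] : exists B : {fset I}, A `<=` B /\
   normc (\sum_(k <- K') \sum_(i <- B) (if p i == k then f i else 0) -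
          \sum_(k <- K') g k) < e / 2.
  have fin : has_sum (fun i => \sum_(k <- K') (if p i == k then f i else 0))
     (\sum_(k <- K') g k).
    by apply: has_sum_sum => k; exact: gk.
  have [B hB] := fin _ (divr2_gt0 e0); exists (A `|` B); split.
    exact: fsubsetUl.
  by rewrite exchange_big; apply: hB; exact: fsubsetUr.
pose C := [fset i in B | p i \in K'].
have AC : A `<=` C.
  apply/fsubsetP => i iA; rewrite !inE (fsubsetP AB) //=.
  by apply: (fsubsetP sub); apply/imfsetP; exists i.
have E : \sum_(k <- K') \sum_(i <- B) (if p i == k then f i else 0) = \sum_(i <- C) f i.
  rewrite exchange_big big_fset /= [RHS]big_mkcond /=; apply: eq_bigr => i _.
  case: ifPn => iK.
    rewrite (big_fsetD1 (p i)) //= eqxx big1_seq ?addr0 // => k.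
    by rewrite !inE => /andP[_ /andP[/negbTE]]; rewrite eq_sym => ->.
  rewrite big1_seq // => k /andP[_ kK]; case: eqP => // pk.
  by rewrite pk kK in iK.
rewrite E in hB; have {}hA := hA C AC.
set S := \sum_(i <- C) _ in hA hB; set T := \sum_(k <- K') _ in hB *.
have -> : T - s = (S - s) - (S - T) by ring.
by apply: le_lt_trans (normcB_le _ _) _; rewrite (splitr e) ltrD.
Qed.

(** Change of index along an injection h; giving a retraction k of h turns the
image of h into a decidable condition. *)
Lemma has_sum_reindex {I J : choiceType} (h : J -> I) (k : I -> J)
    (f : I -> R[i]) s :
  cancel h k -> (forall i, h (k i) != i -> f i = 0) ->
  has_sum (f \o h) s <-> has_sum f s.
Proof.
move=> hK f0.
have sumE (B : {fset I}) :
    \sum_(i <- B) f i = \sum_(j <- k @` [fset i in B | h (k i) == i]) (f \o h) j.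
  rewrite big_imfset /=; last first.
    move=> i i'; rewrite !inE => /andP[_ /eqP Ei] /andP[_ /eqP Ei'] kE.
    by rewrite -Ei -Ei' kE.
  rewrite big_fset /= [RHS]big_mkcond /=; apply: eq_bigr => i _.
  by case: ifPn => [/eqP ->|/f0].
split=> fs e e0; have [A hA] := fs e e0.
  exists (h @` A) => B AB; rewrite sumE; apply: hA.
  apply/fsubsetP => j jA; apply/imfsetP; exists (h j); rewrite ?hK // !inE hK eqxx andbT.
  by apply: (fsubsetP AB); apply/imfsetP; exists j.
exists (k @` [fset i in A | h (k i) == i]) => B AB.
have -> : \sum_(j <- B) (f \o h) j = \sum_(i <- A `|` h @` B) f i.
  rewrite sumE; apply: eq_fbigl => j; apply/idP/imfsetP => [jB|[i0]].
    exists (h j); rewrite ?hK // !inE hK eqxx andbT; apply/orP; right.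
    by apply/imfsetP; exists j.
  rewrite !inE => /andP[/orP[iA|/imfsetP[j' j'B ->]] /eqP Ei] ->; last by rewrite hK.
  by apply: (fsubsetP AB); apply/imfsetP; exists i0; rewrite // !inE iA Ei eqxx.
by apply: hA; exact: fsubsetUl.
Qed.

End UnconditionalSums.
(** * Series and double series *)

Section SumsOverNat.
Context {R : realType}.
Local Notation normc := (@Normc.normc R).
Local Open Scope fset_scope.
Local Open Scope ring_scope.

Lemma sum_fset_le_seq (I : choiceType) (h : I -> R) (A : {fset I}) (s : seq I) :
  (forall i, 0 <= h i) -> uniq s -> {subset A <= s} ->
  \sum_(i <- A) h i <= \sum_(i <- s) h i.
Proof.
move=> h0 us As; have AP : perm_eq A [seq i <- s | i \in A].
  apply: uniq_perm; rewrite ?filter_uniq ?fset_uniq // => i.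
  by rewrite mem_filter; case: (boolP (i \in A)) => // /As ->.
rewrite (perm_big _ AP) big_filter big_mkcond; apply: ler_sum => i _.
by case: ifP.
Qed.

Lemma fset_nat_bound (A : {fset nat}) : exists n, forall i, i \in A -> (i < n)%N.
Proof.
exists (\max_(i <- A) i).+1 => i iA; rewrite ltnS.
exact: (@leq_bigmax_seq _ _ xpredT (fun i => i)).
Qed.

Lemma abs_summable_nat (f : nat -> R[i]) (M : R) :
  (forall n, \sum_(k < n) normc (f k) <= M) -> abs_summable f.
Proof.
move=> fM; exists M => A; have [n An] := fset_nat_bound A.
apply: le_trans (fM n); rewrite -(big_mkord xpredT (fun k => normc (f k))).
apply: sum_fset_le_seq => [i||i /An]; rewrite ?normc_ge0 ?iota_uniq //.
by rewrite mem_index_iota.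
Qed.

Lemma abs_summable_nat2 (f : nat -> nat -> R[i]) (M : R) :
  (forall n, \sum_(j < n) \sum_(k < n) normc (f j k) <= M) ->
  abs_summable (fun p => f p.1 p.2).
Proof.
move=> fM; exists M => A.
have [n1 A1] := fset_nat_bound (fst @` A); have [n2 A2] := fset_nat_bound (snd @` A).
pose n := maxn n1 n2; apply: le_trans (fM n).
have -> : \sum_(j < n) \sum_(k < n) normc (f j k) =
    \sum_(p <- [seq (j, k) | j <- iota 0 n, k <- iota 0 n]) normc (f p.1 p.2).
  rewrite big_allpairs -(big_mkord xpredT (fun j => \sum_(k < n) normc (f j k))).
  rewrite /index_iota subn0; apply: eq_bigr => j _.
  by rewrite -(big_mkord xpredT (fun k => normc (f j k))) /index_iota subn0.
apply: sum_fset_le_seq => [p|| [j k] jkA]; first exact: normc_ge0.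
  by apply: allpairs_uniq; rewrite ?iota_uniq // => -[? ?] [? ?].
rewrite allpairs_f // mem_iota add0n /=.
  by rewrite (leq_trans (A1 j _)) ?leq_maxl //; apply/imfsetP; exists (j, k).
by rewrite (leq_trans (A2 k _)) ?leq_maxr //; apply/imfsetP; exists (j, k).
Qed.

Lemma abs_summable_comp (I J : choiceType) (h : J -> I) (f : I -> R[i]) :
  injective h -> abs_summable f -> abs_summable (f \o h).
Proof.
move=> hI [M fM]; exists M => A; apply: le_trans (fM (h @` A)).
by rewrite big_imfset //= => i j _ _; exact: hI.
Qed.

Lemma sum_iota_fset (V : nmodType) (f : nat -> V) n :
  \sum_(i <- [fset k in iota 0 n]) f i = \sum_(k < n) f k.
Proof.
rewrite -(big_mkord xpredT f); apply: perm_big; apply: uniq_perm.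
- exact: fset_uniq.
- exact: iota_uniq.
- by move=> k; rewrite !inE mem_index_iota mem_iota.
Qed.

Lemma has_sum_nat_finite (f : nat -> R[i]) n :
  (forall k, (n <= k)%N -> f k = 0) -> has_sum f (\sum_(k < n) f k).
Proof.
move=> f0; rewrite -sum_iota_fset; apply: has_sum_finite => k.
by rewrite !inE mem_iota add0n -leqNgt; exact: f0.
Qed.

Lemma has_sum_nat_series (f : nat -> R[i]) s (e : R) : has_sum f s -> 0 < e ->
  exists N, forall n, (N <= n)%N -> normc (\sum_(k < n) f k - s) < e.
Proof.
move=> fs e0; have [A hA] := fs e e0; have [N AN] := fset_nat_bound A.
exists N => n Nn; rewrite -sum_iota_fset; apply: hA; apply/fsubsetP => k /AN kN.
by rewrite !inE mem_iota add0n (leq_trans kN).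
Qed.

Lemma has_sum_shift (f : nat -> R[i]) s :
  has_sum f s -> has_sum (fun n => if n is k.+1 then f k else 0) s.
Proof.
move=> fs; apply/(@has_sum_reindex _ _ _ succn predn) => //.
by case=> // n; rewrite eqxx.
Qed.

Section Fubini.
Context {I J : choiceType}.
Variable f : I -> J -> R[i].

Lemma has_sum_rows (g : I -> R[i]) s : has_sum (fun p => f p.1 p.2) s ->
  (forall i, has_sum (f i) (g i)) -> has_sum g s.
Proof.
move=> fs fg; apply: (has_sum_fiber (p := fst)) fs _ => i.
apply/(@has_sum_reindex _ _ _ (fun j => (i, j)) snd) => // [[i' j]|].
  by rewrite /= xpair_eqE eqxx andbT eq_sym => /negbTE ->.
by have := fg i; congr has_sum; apply/funext => j /=; rewrite eqxx.
Qed.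

Lemma has_sum_columns (g : J -> R[i]) s : has_sum (fun p => f p.1 p.2) s ->
  (forall j, has_sum (f^~ j) (g j)) -> has_sum g s.
Proof.
move=> fs fg; apply: (has_sum_fiber (p := snd)) fs _ => j.
apply/(@has_sum_reindex _ _ _ (fun i => (i, j)) fst) => // [[i j']|].
  by rewrite /= xpair_eqE eqxx andTb eq_sym => /negbTE ->.
by have := fg j; congr has_sum; apply/funext => i /=; rewrite eqxx.
Qed.

End Fubini.

Lemma has_sum_antidiagonals (f : nat -> nat -> R[i]) s :
  has_sum (fun p => f p.1 p.2) s ->
  has_sum (fun n => \sum_(k < n.+1) f k (n - k)%N) s.
Proof.
move=> fs; apply: (has_sum_fiber (p := fun p => p.1 + p.2)%N) fs _ => n.
apply/(@has_sum_reindex _ _ _ (fun k => (k, n - k)%N) fst) => // [[k l]|].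
  rewrite /= xpair_eqE eqxx andTb; have [<-|//] := eqVneq (k + l)%N n.
  by rewrite addKn eqxx.
pose g k := if (k <= n)%N then f k (n - k)%N else 0.
have -> : \sum_(k < n.+1) f k (n - k)%N = \sum_(k < n.+1) g k.
  by apply: eq_bigr => k _; rewrite /g -ltnS ltn_ord.
have gs : has_sum g (\sum_(k < n.+1) g k).
  by apply: has_sum_nat_finite => k nk; rewrite /g leqNgt nk.
move: gs; congr has_sum; apply/funext => k /=; rewrite /g.
case: leqP => kn; first by rewrite subnKC ?eqxx.
by rewrite ifN //; apply/eqP => E; rewrite -E ltnNge leq_addr in kn.
Qed.

Lemma has_sum_cauchy_product (f g : nat -> R[i]) s t :
  has_sum f s -> has_sum g t ->
  has_sum (fun n => \sum_(k < n.+1) f k * g (n - k)%N) (s * t).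
Proof.
move=> fs gt.
have [Mf fM] := has_sum_abs_summable fs; have [Mg gM] := has_sum_abs_summable gt.
have [S FS] : exists S, has_sum (fun p => f p.1 * g p.2) S.
  apply: abs_summable_has_sum; apply: (@abs_summable_nat2 (fun i j => f i * g j) (Mf * Mg)) => n.
  under eq_bigr do (under eq_bigr do rewrite Normc.normcM; rewrite -mulr_sumr).
  rewrite -mulr_suml; apply: ler_pM; rewrite ?sumr_ge0 // => *; rewrite ?normc_ge0 //.
    by rewrite -(sum_iota_fset (fun k => normc (f k))).
  by rewrite -(sum_iota_fset (fun k => normc (g k))).
have := has_sum_rows (f := fun i j => f i * g j) FS (fun i => has_sumZ (f i) gt).
under eq_fun do rewrite mulrC.
move=> /has_sum_unique -/(_ _ (has_sumZ t fs)) E.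
rewrite mulrC -E; exact: (@has_sum_antidiagonals (fun i j => f i * g j) _ FS).
Qed.

Definition hsum (f : nat -> R[i]) : R[i] := xget 0 [set s | has_sum f s].

Lemma hsumE f s : has_sum f s -> hsum f = s.
Proof.
move=> fs; rewrite /hsum; case: xgetP => [x _ /= fx|/(_ s)/(_ fs)//].
exact: has_sum_unique fx fs.
Qed.

Lemma hsumP f : abs_summable f -> has_sum f (hsum f).
Proof. by case/abs_summable_has_sum => s fs; rewrite (hsumE fs). Qed.

End SumsOverNat.
(** * The binomial series *)

(** The coefficient of T^n in (1 - T)^(-a). *)
Definition rising_coef {F : fieldType} (a : F) n : F :=
  (\prod_(j < n) (a + j%:R)) / n`!%:R.

Lemma rising_coef0 {F : fieldType} (a : F) : rising_coef a 0 = 1.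
Proof. by rewrite /rising_coef big_ord0 fact0 divr1. Qed.

Lemma rising_prod_recl {F : fieldType} (a : F) n :
  \prod_(j < n.+1) (a + j%:R) = a * \prod_(j < n) (a + 1 + j%:R).
Proof.
rewrite big_ord_recl /= addr0; congr (_ * _).
by apply: eq_bigr => j _; rewrite /bump /= add1n -nat1r addrA.
Qed.

(** Pascal's rule: multiplication by 1 - T turns the series of (1 - T)^(-a-1)
into that of (1 - T)^(-a). *)
Lemma rising_coef_pascal {F : numFieldType} (a : F) n :
  rising_coef (a + 1) n.+1 = rising_coef (a + 1) n + rising_coef a n.+1.
Proof.
rewrite /rising_coef [\prod_(j < n.+1) (a + 1 + _)]big_ord_recr.
rewrite rising_prod_recl /=.
set P := \prod_(j < n) _; rewrite factS natrM.
have n0 : (n.+1%:R : F) != 0 by rewrite pnatr_eq0.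
have f0 : (n`!%:R : F) != 0 by rewrite pnatr_eq0 -lt0n fact_gt0.
have -> : (n.+1%:R : F) = n%:R + 1 by rewrite -natr1.
by field; rewrite natr1 n0 f0.
Qed.

Section BinomialSeries.
Context {R : realType}.
Implicit Types (mu T : R[i]) (x : R).
Local Notation normc := (@Normc.normc R).

(** Pascal's rule gives (1 - x) S <= S' between the partial sums for exponents
L + 1 and L, so the bound follows by induction on L without summing the series. *)
Lemma sum_rising_coef_le (L n : nat) x : 0 <= x < 1 ->
  \sum_(j < n) rising_coef (L%:R : R) j * x ^+ j <= (1 - x)^-1 ^+ L.
Proof.
move=> /andP[x0 x1]; have y0 : 0 < 1 - x by rewrite subr_gt0.
have coef_ge0 l j : 0 <= rising_coef (l%:R : R) j.
  by rewrite divr_ge0 // prodr_ge0 // => i _; rewrite addr_ge0.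
elim: L n => [|L IH] n.
  case: n => [|n]; first by rewrite big_ord0.
  rewrite big_ord_recl rising_coef0 big1 ?addr0 ?mulr1 //= => i _.
  by rewrite /rising_coef big_ord_recl /= !(addr0, mul0r).
rewrite exprS mulrC ler_pdivlMr //.
case: n => [|n]; first by rewrite big_ord0 mul0r exprn_ge0 // invr_ge0 ltW.
apply: le_trans (IH n.+1).
pose S m := \sum_(j < m) rising_coef (L.+1%:R : R) j * x ^+ j.
have S_rec : S n.+1 = S n * x + \sum_(j < n.+1) rising_coef (L%:R : R) j * x ^+ j.
  rewrite /S !big_ord_recl !rising_coef0 addrCA; congr (_ + _).
  rewrite mulr_suml -big_split /=; apply: eq_bigr => j _.
  by rewrite /bump /= add1n -natr1 rising_coef_pascal mulrDl exprSr mulrA.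
have S_le : S n <= S n.+1 by rewrite /S big_ord_recr lerDl mulr_ge0 ?exprn_ge0.
rewrite -/(S n.+1) mulrBr mulr1 {1}S_rec lerBlDr addrC lerD2l.
by rewrite ler_wpM2r.
Qed.

Lemma normc_rising_coef_le mu (L j : nat) : normc mu <= L%:R ->
  normc (rising_coef mu j) <= rising_coef (L%:R : R) j.
Proof.
move=> muL; rewrite normc_div normc_nat ler_wpM2r ?invr_ge0 //.
rewrite (big_morph normc (@Normc.normcM R) (@Normc.normc1 R)).
apply: ler_prod => i _; rewrite normc_ge0 /=.
by apply: le_trans (normcD_le _ _) _; rewrite normc_nat lerD2r.
Qed.

(** The bound is geometric in N, as needed to sum over N afterwards; a natural
majorant L of the modulus of mu reduces it to integer exponents. *)
Lemma sum_normc_binomial_le mu T (L N n : nat) : normc T < 1 -> normc mu <= L%:R ->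
  \sum_(j < n) normc (rising_coef (mu + N%:R) j * T ^+ j)
    <= (1 - normc T)^-1 ^+ (L + N).
Proof.
move=> T1 muL; apply: le_trans (_ : \sum_(j < n) rising_coef (L + N)%:R j * normc T ^+ j <= _).
  apply: ler_sum => j _; rewrite Normc.normcM normcX ler_wpM2r ?exprn_ge0 ?normc_ge0 //.
  apply: normc_rising_coef_le; apply: le_trans (normcD_le _ _) _.
  by rewrite normc_nat natrD lerD2r.
by apply: sum_rising_coef_le; rewrite normc_ge0.
Qed.

Lemma normc_nat_bound mu : exists L : nat, normc mu <= L%:R.
Proof. by exists (Num.bound (normc mu)); rewrite ltW // archi_boundP // normc_ge0. Qed.

Lemma binomial_abs_summable mu T : normc T < 1 ->
  abs_summable (fun n => rising_coef mu n * T ^+ n).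
Proof.
move=> T1; have [L muL] := normc_nat_bound mu.
apply: (abs_summable_nat (M := (1 - normc T)^-1 ^+ (L + 0))) => n.
by have := sum_normc_binomial_le 0 n T1 muL; rewrite addr0.
Qed.

Definition binomial_sum mu T : R[i] := hsum (fun n => rising_coef mu n * T ^+ n).

Lemma binomial_has_sum mu T : normc T < 1 ->
  has_sum (fun n => rising_coef mu n * T ^+ n) (binomial_sum mu T).
Proof. by move=> T1; apply: hsumP; exact: binomial_abs_summable. Qed.

Lemma binomial_sum_succ mu T : normc T < 1 ->
  binomial_sum (mu + 1) T * (1 - T) = binomial_sum mu T.
Proof.
move=> T1; apply/esym/hsumE.
have h1 := binomial_has_sum (mu + 1) T1.
have h2 := has_sumB h1 (has_sumZ T (has_sum_shift h1)).
rewrite mulrBr mulr1 [_ * T]mulrC; move: h2; congr has_sum; apply/funext => -[|n].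
  by rewrite mulr0 subr0 !rising_coef0.
by rewrite rising_coef_pascal exprS; ring.
Qed.

Lemma normc_lt1_neq0 T : normc T < 1 -> 1 - T != 0.
Proof.
by apply: contraTneq => /eqP; rewrite subr_eq0 => /eqP <-; rewrite Normc.normc1 ltxx.
Qed.

Lemma binomial_sum_shift mu T N : normc T < 1 ->
  binomial_sum (mu + N%:R) T = binomial_sum mu T / (1 - T) ^+ N.
Proof.
move=> T1; have T0 := normc_lt1_neq0 T1; elim: N => [|N IH].
  by rewrite addr0 expr0 divr1.
rewrite exprSr invfM mulrA -IH -natr1 addrA.
by rewrite -(binomial_sum_succ (mu + N%:R) T1) mulfK.
Qed.

Lemma binomial_sum0 T : binomial_sum 0 T = 1.
Proof.
apply: hsumE; have := @has_sum_nat_finite _ (fun n => rising_coef 0 n * T ^+ n) 1.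
rewrite big_ord1 rising_coef0 mulr1; apply => -[//|n] _.
by rewrite /rising_coef big_ord_recl /= !(addr0, mul0r).
Qed.

End BinomialSeries.

(** * Power series and analytic functions *)

Section PowerSeries.
Context {R : realType}.
Implicit Types (a z v T : R[i]) (c e : nat -> R[i]) (F G : R[i] -> R[i]).
Local Notation normc := (@Normc.normc R).

Definition power_series_on c (r : R) F :=
  forall z, normc z <= r -> has_sum (fun n => c n * z ^+ n) (F z).

Definition analytic_at F a :=
  exists c, exists2 d : R, 0 < d & power_series_on c d (fun v => F (a + v)).

Lemma abs_summable_partial_sums (f : nat -> R[i]) : abs_summable f ->
  exists M : R, forall n, \sum_(k < n) normc (f k) <= M.
Proof.
move=> [M fM]; exists M => n.
by rewrite -(sum_iota_fset (fun k => normc (f k))).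
Qed.

Lemma abs_summable_power_le c z z' : normc z' <= normc z ->
  abs_summable (fun n => c n * z ^+ n) -> abs_summable (fun n => c n * z' ^+ n).
Proof.
move=> zz'; apply: abs_summable_le => n.
rewrite !Normc.normcM !normcX ler_wpM2l ?normc_ge0 //.
by rewrite lerXn2r // nnegrE normc_ge0.
Qed.

Lemma power_series_on_abs_summable c (r : R) F z : power_series_on c r F ->
  normc z <= r -> abs_summable (fun n => c n * z ^+ n).
Proof. by move=> cF zr; exact: has_sum_abs_summable (cF z zr). Qed.

Lemma sum_binomial_expansion (K : numFieldType) (x y : K) n m : (n < m)%N ->
  \sum_(j < m) 'C(n, j)%:R * x ^+ (n - j) * y ^+ j = (x + y) ^+ n.
Proof.
move=> nm; rewrite exprDn (big_ord_widen m (fun j => x ^+ (n - j) * y ^+ j *+ 'C(n, j))) //.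
rewrite [RHS]big_mkcond /=; apply: eq_bigr => j _; case: ltnP => nj.
  by rewrite -mulrA mulr_natl.
by rewrite bin_small // !mul0r.
Qed.

(** Re-expansion at a: expand (a + v)^n by the binomial formula and exchange the
two sums. The double series is dominated by the terms of the series at r since
|a| + |v| <= r. *)
Lemma power_series_on_analytic_at c (r : R) F a :
  power_series_on c r F -> normc a < r -> analytic_at F a.
Proof.
move=> cF ar; pose d := r - normc a; have d0 : 0 < d by rewrite subr_gt0.
have r0 : 0 <= r by apply: le_trans (ltW ar); exact: normc_ge0.
pose g n j := c n * ('C(n, j)%:R * a ^+ (n - j)).
have dC : normc d%:C = d by rewrite normc_real ger0_norm // ltW.
have sumg v : normc v <= d -> abs_summable (fun p => g p.1 p.2 * v ^+ p.2).
  move=> vd; have : abs_summable (fun n => c n * r%:C ^+ n).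
    by apply: (power_series_on_abs_summable cF); rewrite normc_real ger0_norm.
  move=> /abs_summable_partial_sums[M cM].
  apply: (@abs_summable_nat2 _ (fun n j => g n j * v ^+ j) M) => m.
  apply: le_trans (cM m); apply: ler_sum => n _.
  rewrite (eq_bigr (fun j : 'I_m => normc (c n) *
     ('C(n, j)%:R * normc a ^+ (n - j) * normc v ^+ j))); last first.
    by move=> j _; rewrite !Normc.normcM !normcX normc_nat !mulrA.
  rewrite -mulr_sumr sum_binomial_expansion // Normc.normcM normcX.
  rewrite ler_wpM2l ?normc_ge0 // normc_real ger0_norm // lerXn2r ?nnegrE ?addr_ge0 ?normc_ge0 //.
  by rewrite -lerBrDl.
(* The new coefficients: convergent columns, seen at v = d and divided by d^j. *)
have slice j : exists s, has_sum (fun n => g n j) s.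
  have := @abs_summable_comp _ _ _ (fun n => (n, j)) _ _ (sumg d%:C _).
  case/(_ _ _)/abs_summable_has_sum => [n n' []//||s sP]; first by rewrite dC.
  have dj : d%:C ^+ j != 0 by rewrite -normc_eq0 normcX dC expf_neq0 // gt_eqF.
  exists ((d%:C ^+ j)^-1 * s); have := has_sumZ (d%:C ^+ j)^-1 sP.
  by congr has_sum; apply/funext => n /=; rewrite mulrC mulfK.
have [c' c'P] := choice slice.
exists c'; exists d => // v vd.
have [S gS] := abs_summable_has_sum (sumg v vd).
have hr : has_sum (fun n => c n * (a + v) ^+ n) S.
  apply: (has_sum_rows (f := fun n j => g n j * v ^+ j)) gS _ => n.
  rewrite -(sum_binomial_expansion a v (ltnSn n)) mulr_sumr.
  rewrite (eq_bigr (fun j : 'I_n.+1 => g n j * v ^+ j)); last first.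
    by move=> j _; rewrite /g !mulrA.
  apply: has_sum_nat_finite => j nj.
  by rewrite /g bin_small // mul0r mulr0 mul0r.
have -> : F (a + v) = S.
  apply: has_sum_unique hr; apply: cF; apply: le_trans (normcD_le _ _) _.
  by rewrite -lerBrDl.
apply: (has_sum_columns (f := fun n j => g n j * v ^+ j)) gS _ => j.
by have := has_sumZ (v ^+ j) (c'P j); rewrite mulrC; under eq_fun do rewrite mulrC.
Qed.

Lemma analytic_atM F G a : analytic_at F a -> analytic_at G a ->
  analytic_at (fun z => F z * G z) a.
Proof.
move=> [c [d d0 cF]] [c' [d' d'0 cG]].
exists (fun n => \sum_(k < n.+1) c k * c' (n - k)%N); exists (Num.min d d').
  by rewrite lt_min d0.
move=> v; rewrite le_min => /andP[vd vd'].
have := has_sum_cauchy_product (cF v vd) (cG v vd'); congr has_sum.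
apply/funext => n; rewrite mulr_suml; apply: eq_bigr => k _.
by rewrite mulrACA -exprD subnKC // -ltnS.
Qed.

Lemma analytic_atB F G a : analytic_at F a -> analytic_at G a ->
  analytic_at (fun z => F z - G z) a.
Proof.
move=> [c [d d0 cF]] [c' [d' d'0 cG]].
exists (fun n => c n - c' n); exists (Num.min d d'); first by rewrite lt_min d0.
move=> v; rewrite le_min => /andP[vd vd'].
have := has_sumB (cF v vd) (cG v vd'); congr has_sum.
by apply/funext => n; rewrite mulrBl.
Qed.

End PowerSeries.
(** * The Euler transform and analytic continuation *)

Section EulerTransform.
Context {R : realType}.
Implicit Types (a z v T t mu lambda : R[i]) (c e : nat -> R[i]) (F f u : R[i] -> R[i]).
Local Notation normc := (@Normc.normc R).

(** The variable w of the Euler transform. *)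
Definition euler_map T := - T / (1 - T).

(** The coefficient of T^n in (1 - T)^(- mu) sum_N e_N w^N. *)
Definition euler_coef mu e n :=
  \sum_(N < n.+1) e N * (-1) ^+ N * rising_coef (mu + N%:R) (n - N).

Lemma normc_1sub_ge T : 1 - normc T <= normc (1 - T).
Proof.
rewrite lerBlDr; apply: le_trans (normcD_le _ _).
by rewrite subrK Normc.normc1.
Qed.

Lemma normc_euler_map_le T : normc T < 1 ->
  normc (euler_map T) <= normc T / (1 - normc T).
Proof.
move=> T1; rewrite normc_div normc_opp ler_wpM2l ?normc_ge0 // lef_pV2 ?posrE ?subr_gt0 //.
  exact: normc_1sub_ge.
by rewrite normc_gt0 normc_lt1_neq0.
Qed.

(** The double series with terms e_N (-T)^N (mu + N)_j T^j / j! is summed in two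
ways: along N it gives (1 - T)^(-mu) sum_N e_N w^N, along the antidiagonals it
gives the powers of T. Its absolute convergence requires the series of e at
|T| / (1 - |T|) and not only at w. *)
Lemma euler_transform mu e T s : normc T < 1 ->
  abs_summable (fun N => e N * (normc T / (1 - normc T))%:C ^+ N) ->
  has_sum (fun N => e N * euler_map T ^+ N) s ->
  has_sum (fun n => euler_coef mu e n * T ^+ n) (binomial_sum mu T * s).
Proof.
move=> T1 /abs_summable_partial_sums[M eM] es.
have y0 : 0 < 1 - normc T by rewrite subr_gt0.
have [L muL] := normc_nat_bound mu.
pose f N j := e N * (- T) ^+ N * (rising_coef (mu + N%:R) j * T ^+ j).
have [S fS] : exists S, has_sum (fun p => f p.1 p.2) S.
  apply: abs_summable_has_sum.
  apply: (@abs_summable_nat2 _ f ((1 - normc T)^-1 ^+ L * M)) => n.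
  apply: le_trans (_ : \sum_(N < n) (1 - normc T)^-1 ^+ L *
     normc (e N * (normc T / (1 - normc T))%:C ^+ N) <= _); last first.
    by rewrite -mulr_sumr ler_wpM2l ?eM // exprn_ge0 // invr_ge0 ltW.
  apply: ler_sum => N _; rewrite /f; under eq_bigr do rewrite Normc.normcM.
  rewrite -mulr_sumr !Normc.normcM !normcX normc_opp normc_real.
  rewrite ger0_norm ?divr_ge0 ?normc_ge0 ?(ltW y0) //.
  apply: le_trans (ler_wpM2l _ (sum_normc_binomial_le N n T1 muL)) _.
    by rewrite mulr_ge0 ?exprn_ge0 ?normc_ge0.
  by rewrite exprD [(normc T / _) ^+ _]exprMn le_eqVlt; apply/orP; left; apply/eqP; ring.
have rows N : has_sum (f N) (binomial_sum mu T * (e N * euler_map T ^+ N)).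
  have := has_sumZ (e N * (- T) ^+ N) (binomial_has_sum (mu + N%:R) T1).
  rewrite binomial_sum_shift // /euler_map exprMn exprVn.
  by rewrite mulrCA -mulrA.
have -> : binomial_sum mu T * s = S.
  exact: has_sum_unique (has_sumZ _ es) (has_sum_rows fS rows).
have := has_sum_antidiagonals fS; congr has_sum; apply/funext => n.
rewrite /euler_coef mulr_suml; apply: eq_bigr => N _.
have -> : T ^+ n = T ^+ N * T ^+ (n - N) by rewrite -exprD subnKC // -ltnS.
by rewrite /f [(- T) ^+ N]exprNn; ring.
Qed.

(** With q = 1 / (1 - a) and T = q v,
euler_map (a + v) - euler_map a = q * euler_map T, so that the expansion of f at
euler_map a is carried to a power series in v by the Euler transform of
parameter 0, whose binomial factor is 1. *)
Lemma analytic_at_euler_map f a : a != 1 ->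
  analytic_at f (euler_map a) -> analytic_at (fun T => f (euler_map T)) a.
Proof.
move=> a1 [c [d d0 cf]]; pose q := (1 - a)^-1.
have q0 : 1 - a != 0 by rewrite subr_eq0 eq_sym.
have nq : 0 < normc q by rewrite normc_gt0 invr_neq0.
pose y := Num.min (1 / 2) (d / (2 * normc q)).
have y0 : 0 < y by rewrite lt_min !divr_gt0 // mulr_gt0.
have y2 : y <= 1 / 2 by rewrite ge_min lexx.
have yq : normc q * (2 * y) <= d.
  have : y <= d / (2 * normc q) by rewrite ge_min lexx orbT.
  rewrite ler_pdivlMr ?mulr_gt0 //; lra.
exists (fun n => euler_coef 0 (fun N => c N * q ^+ N) n * q ^+ n).
exists (y / normc q); first by rewrite divr_gt0.
move=> v vy; pose T := q * v.
have Ty : normc T <= y by move: vy; rewrite ler_pdivlMr // Normc.normcM mulrC.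
have T1 : normc T < 1 by apply: le_lt_trans Ty _; apply: le_lt_trans y2 _; lra.
have ratio : normc T / (1 - normc T) <= 2 * y.
  have h := normc_ge0 T; rewrite ler_pdivrMr ?subr_gt0 //.
  have : 0 <= y * (1 - 2 * normc T) by rewrite mulr_ge0 ?(ltW y0) //; lra.
  lra.
have ratio0 : 0 <= normc T / (1 - normc T).
  by rewrite divr_ge0 ?normc_ge0 // subr_ge0 ltW.
have qd x : x <= 2 * y -> normc q * x <= d.
  by move=> xy; apply: le_trans yq; rewrite ler_wpM2l // ltW.
(* The functional equation of euler_map at a. *)
have incr : q * euler_map T = euler_map (a + v) - euler_map a.
  have av : 1 - (a + v) != 0.
    have -> : 1 - (a + v) = (1 - a) * (1 - T) by rewrite /T /q mulrBr mulr1 mulVKf // opprD addrA.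
    by rewrite mulf_neq0 // normc_lt1_neq0.
  by rewrite /euler_map /T /q; field; rewrite q0 av.
have pw z : (fun N => c N * (q * z) ^+ N) = (fun N => c N * q ^+ N * z ^+ N).
  by apply/funext => N; rewrite exprMn mulrA.
have H1 : abs_summable (fun N => c N * q ^+ N * (normc T / (1 - normc T))%:C ^+ N).
  rewrite -pw; apply: (power_series_on_abs_summable cf).
  by rewrite Normc.normcM normc_real ger0_norm // qd.
have H2 : has_sum (fun N => c N * q ^+ N * euler_map T ^+ N) (f (euler_map (a + v))).
  have -> : euler_map (a + v) = euler_map a + q * euler_map T by rewrite incr [RHS]addrC subrK.
  rewrite -pw; apply: cf.
  rewrite Normc.normcM; apply: qd.
  exact: le_trans (normc_euler_map_le T1) ratio.
have := euler_transform 0 T1 H1 H2; rewrite binomial_sum0 mul1r.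
by congr has_sum; apply/funext => n; rewrite /T exprMn mulrA.
Qed.

Lemma power_lipschitz (r : R) n : 0 <= r -> exists2 K : R, 0 <= K &
  forall z z', normc z <= r -> normc z' <= r ->
    normc (z' ^+ n - z ^+ n) <= K * normc (z' - z).
Proof.
move=> r0; elim: n => [|n [K K0 IH]].
  by exists 0 => // z z' _ _; rewrite !expr0 subrr Normc.normc0 mul0r.
exists (r * K + r ^+ n) => [|z z' zr z'r]; first by rewrite addr_ge0 ?mulr_ge0 ?exprn_ge0.
have -> : z' ^+ n.+1 - z ^+ n.+1 = z' * (z' ^+ n - z ^+ n) + z ^+ n * (z' - z).
  by rewrite !exprS; ring.
apply: le_trans (normcD_le _ _) _; rewrite !Normc.normcM normcX mulrDl lerD //.
  by rewrite -mulrA ler_pM ?normc_ge0 // IH.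
by rewrite ler_wpM2r ?normc_ge0 // lerXn2r ?nnegrE ?normc_ge0.
Qed.

Lemma polynomial_lipschitz c (r : R) n : 0 <= r -> exists2 K : R, 0 <= K &
  forall z z', normc z <= r -> normc z' <= r ->
    normc (\sum_(k < n) (c k * z' ^+ k - c k * z ^+ k)) <= K * normc (z' - z).
Proof.
move=> r0; elim: n => [|n [K K0 IH]].
  by exists 0 => // z z' _ _; rewrite big_ord0 Normc.normc0 mul0r.
have [K' K'0 pK'] := power_lipschitz n r0.
exists (K + normc (c n) * K') => [|z z' zr z'r]; first by rewrite addr_ge0 ?mulr_ge0 ?normc_ge0.
rewrite big_ord_recr /=; apply: le_trans (normcD_le _ _) _.
rewrite mulrDl lerD ?IH // -mulrBr Normc.normcM -mulrA.
by rewrite ler_wpM2l ?normc_ge0 ?pK'.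
Qed.

(** The bound holds up to the boundary of the disc of absolute convergence: the
tails are uniformly small there, and the remaining polynomial is Lipschitz. *)
Lemma power_series_on_continuous c (r : R) F (e : R) : 0 <= r ->
  power_series_on c r F -> 0 < e -> exists2 d : R, 0 < d &
  forall z z', normc z <= r -> normc z' <= r -> normc (z' - z) < d ->
    normc (F z' - F z) < e.
Proof.
move=> r0 cF e0; have e8 : 0 < e / 8 by rewrite divr_gt0.
have rC : normc r%:C = r by rewrite normc_real ger0_norm.
have [s sP] : exists s, has_sum (fun n => (normc (c n) * r ^+ n)%:C) s.
  apply: abs_summable_has_sum; apply: abs_summable_le (fun n => c n * r%:C ^+ n) _ _; last first.
    by apply: (power_series_on_abs_summable cF); rewrite rC.
  move=> n; rewrite normc_real Normc.normcM normcX rC ger0_norm //.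
  by rewrite mulr_ge0 ?normc_ge0 ?exprn_ge0.
have [N NP] := has_sum_nat_series sP e8.
have tail n z : (N <= n)%N -> normc z <= r ->
    normc (\sum_(N <= k < n) c k * z ^+ k) <= e / 4.
  move=> Nn zr; apply: le_trans (normc_sum_le _ _ _) _.
  apply: le_trans (_ : \sum_(N <= k < n) normc (c k) * r ^+ k <= _).
    apply: ler_sum => k _; rewrite Normc.normcM normcX ler_wpM2l ?normc_ge0 //.
    by rewrite lerXn2r ?nnegrE ?normc_ge0.
  have := NP _ Nn; have := NP _ (leqnn N); rewrite -!rmorph_sum.
  rewrite -(big_mkord xpredT (fun k => normc (c k) * r ^+ k)).
  rewrite -(big_mkord xpredT (fun k => normc (c k) * r ^+ k)).
  rewrite (big_cat_nat (n := N) (p := n)) //= => h1 h2.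
  set U := \sum_(0 <= k < N) _ in h1 h2; set V := \sum_(N <= k < n) _ in h2 *.
  apply: le_trans (ler_norm _) _; rewrite -normc_real.
  have -> : V%:C = ((U + V)%:C - s) - (U%:C - s) by rewrite rmorphD /=; ring.
  by apply: le_trans (normcB_le _ _) _; move: h1 h2; lra.
have [K K0 pK] := polynomial_lipschitz c N r0.
exists (e / 8 / (K + 1)) => [|z z' zr z'r]; first by rewrite divr_gt0 // ltr_wpDl.
rewrite ltr_pdivlMr ?ltr_wpDl // => zz'.
have {zz'}poly : normc (\sum_(k < N) (c k * z' ^+ k - c k * z ^+ k)) < e / 8.
  apply: le_lt_trans (pK _ _ zr z'r) _; apply: le_lt_trans zz'.
  by rewrite mulrC ler_wpM2l ?normc_ge0 // lerDl.
have [N' N'P] := has_sum_nat_series (has_sumB (cF z' z'r) (cF z zr)) e8.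
pose n := maxn N N'.
have := N'P n (leq_maxr _ _); move: poly.
rewrite -!(big_mkord xpredT (fun k => c k * z' ^+ k - c k * z ^+ k)).
rewrite (big_cat_nat (n := N) (p := n)) ?leq_maxl //= [X in _ + X - _]sumrB.
have := tail n z (leq_maxl _ _) zr; have := tail n z' (leq_maxl _ _) z'r.
set B := \sum_(N <= k < n) _; set C := \sum_(N <= k < n) _; set A := \sum_(0 <= k < N) _.
move=> hB hC hA; set D := F z' - F z => hD.
have -> : D = A + (B - C) - ((A + (B - C)) - D) by ring.
apply: le_lt_trans (normcB_le _ _) _.
have := normcD_le A (B - C); have := normcB_le B C; lra.
Qed.

(** Once the first n coefficients vanish, F z / z^n is a power series with
constant term c n, continuous at 0 and zero at the points x a with x > 0 small. *)
Lemma power_series_zero_coef c (d h : R) F a : 0 < d -> power_series_on c d F ->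
  a != 0 -> 0 < h -> (forall x : R, 0 < x < h -> F (x%:C * a) = 0) ->
  forall n, c n = 0.
Proof.
move=> d0 cF a0 h0 F0; have na : 0 < normc a by rewrite normc_gt0.
elim/ltn_ind => n IH; pose G z := if z == 0 then c n else F z / z ^+ n.
have cG : power_series_on (fun k => c (n + k)%N) d G.
  move=> z zd; rewrite /G; case: eqP => [->|/eqP z0].
    have := @has_sum_nat_finite _ (fun k => c (n + k)%N * 0 ^+ k) 1.
    rewrite big_ord1 addn0 expr0 mulr1; apply => -[//|k] _.
    by rewrite expr0n mulr0.
  have shifted : has_sum (fun k => c (n + k)%N * z ^+ (n + k)) (F z).
    apply/(@has_sum_reindex _ _ _ (addn n) (subn^~ n) (fun k => c k * z ^+ k)).
    - by move=> k; rewrite addKn.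
    - move=> k; have [kn _|nk] := ltnP k n; first by rewrite IH ?mul0r.
      by rewrite subnKC // eqxx.
    - exact: cF.
  have := has_sumZ (z ^+ n)^-1 shifted; rewrite mulrC; congr has_sum.
  by apply/funext => k; rewrite exprD; field; rewrite expf_neq0.
apply: normc_small_eq0 => e e0.
have [d' d'0 hd'] := power_series_on_continuous (ltW d0) cG e0.
(* A point x a inside the disc, close to 0, at which F vanishes. *)
pose x := Num.min (h / 2) (Num.min (d / (2 * normc a)) (d' / (2 * normc a))).
have x0 : 0 < x by rewrite !lt_min !divr_gt0 ?mulr_gt0.
have xh : x < h.
  have : x <= h / 2 by rewrite ge_min lexx.
  by move: h0; lra.
have nx : normc (x%:C * a) = x * normc a.
  by rewrite Normc.normcM normc_real ger0_norm // ltW.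
have xd : x * normc a <= d / 2.
  have : x <= d / (2 * normc a) by rewrite !ge_min lexx !orbT.
  by rewrite ler_pdivlMr ?mulr_gt0 //; lra.
have xd' : x * normc a <= d' / 2.
  have : x <= d' / (2 * normc a) by rewrite !ge_min lexx !orbT.
  by rewrite ler_pdivlMr ?mulr_gt0 //; lra.
have xa0 : x%:C * a != 0 by rewrite -normc_eq0 nx gt_eqF // mulr_gt0.
have := hd' (x%:C * a) 0; rewrite sub0r normc_opp Normc.normc0 nx /G eqxx (negbTE xa0).
by rewrite F0 ?x0 // mul0r subr0 => H; apply/ltW/H; move: d0 d'0 xd xd'; lra.
Qed.

(** The identity theorem along a segment. If u vanishes on [0, m) with m the
supremum of the admissible endpoints, its expansion at m t vanishes on the points
before m, hence has zero coefficients, and u vanishes beyond m as well. *)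
Lemma analytic_ray_identity u t (r : R) : t != 0 -> 0 < r ->
  (forall z, normc z <= r -> u z = 0) ->
  (forall s : R, 0 <= s < 1 -> analytic_at u (s%:C * t)) ->
  forall s : R, 0 <= s < 1 -> u (s%:C * t) = 0.
Proof.
move=> t0 r0 ur uan s1 /andP[s10 s11]; apply/eqP/negPn/negP => /eqP us1.
have nt : 0 < normc t by rewrite normc_gt0.
have nst (s : R) : normc (s%:C * t) = `|s| * normc t by rewrite Normc.normcM normc_real.
pose E := [set s : R | s <= s1 /\ forall s', 0 <= s' <= s -> u (s'%:C * t) = 0].
have small (s : R) : 0 <= s <= r / normc t -> u (s%:C * t) = 0.
  by move=> /andP[s0]; rewrite ler_pdivlMr // => sr; apply: ur; rewrite nst ger0_norm.
have rs1 : r / normc t < s1.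
  by rewrite ltNge; apply/negP => le1; apply: us1; apply: small; rewrite s10.
have Er : E (r / normc t) by split => //; exact: ltW.
have supE : has_sup E by split; [exists (r / normc t)|exists s1 => s []].
pose m := sup E.
have m0 : 0 < m by apply: lt_le_trans (sup_upper_bound supE Er); rewrite divr_gt0.
have ms1 : m <= s1 by apply: ge_sup supE.1 _ => s [].
have um (s : R) : 0 <= s < m -> u (s%:C * t) = 0.
  move=> /andP[s0 sm]; have [|s' [_ Es'] ss'] := @sup_adherent _ E (m - s) _ supE.
    by rewrite subr_gt0.
  by apply: Es'; rewrite s0 /=; apply: ltW; move: ss'; rewrite -/m; lra.
have [|c [d d0 cu]] := uan m; first by rewrite ltW //= (le_lt_trans ms1).
have c0 : forall n, c n = 0.
  apply: (power_series_zero_coef (a := - t) (h := m) d0 cu); rewrite ?oppr_eq0 // => x /andP[x0 xm].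
  have -> : m%:C * t + x%:C * - t = (m - x)%:C * t by rewrite rmorphB /=; ring.
  by apply: um; rewrite subr_ge0 (ltW xm) ltrBlDr ltrDl.
(* All coefficients at m t being zero, u vanishes past m t too. *)
have beyond (s : R) : m <= s <= m + d / normc t -> u (s%:C * t) = 0.
  move=> /andP[ms sd]; have -> : s%:C * t = m%:C * t + (s - m)%:C * t by rewrite rmorphB /=; ring.
  have := cu ((s - m)%:C * t); rewrite nst ger0_norm ?subr_ge0 //.
  rewrite -ler_pdivlMr // lerBlDl => /(_ sd) /has_sum_unique; apply.
  under eq_fun do rewrite c0 mul0r.
  by have := @has_sum_nat_finite R (fun=> 0) 0; rewrite big_ord0; apply.
have [le1|lt1] := leP s1 (m + d / normc t); first by apply: us1; apply: beyond; rewrite ms1.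
have : E (m + d / normc t).
  split=> [|s /andP[s0 sd]]; first exact: ltW.
  by have [sm|ms] := ltP s m; [apply: um; rewrite s0|apply: beyond; rewrite ms].
move=> /(sup_upper_bound supE); rewrite -/m gerDl leNgt divr_gt0 //.
Qed.

End EulerTransform.
(** * Abel's theorem and Euler summation *)

Section AbelAndEulerSummation.
Context {R : realType}.
Implicit Types (z T t lambda s : R[i]) (a b c e : nat -> R[i]) (x : R).
Local Notation normc := (@Normc.normc R).

Definition series_to b s := forall eps : R, 0 < eps -> exists N, forall n, (N <= n)%N ->
  normc (\sum_(k < n) b k - s) < eps.

(** Left limits at 1. The points are kept nonnegative because the bounds on the
segment from 0 to t hold for parameters in [0, 1) only. *)
Definition left_lim1 (g : R -> R[i]) s := forall eps : R, 0 < eps ->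
  exists2 d : R, 0 < d & forall x, 1 - d < x < 1 -> 0 <= x -> normc (g x - s) < eps.

Lemma series_to_unique b s s' : series_to b s -> series_to b s' -> s = s'.
Proof.
move=> bs bs'; apply/eqP; rewrite -subr_eq0; apply/eqP/normc_small_eq0 => e e0.
have [N hN] := bs _ (divr2_gt0 e0); have [N' hN'] := bs' _ (divr2_gt0 e0).
have := hN _ (leq_maxl N N'); have := hN' _ (leq_maxr N N').
set S := \sum_(k < _) _ => h' h; have -> : s - s' = (S - s') - (S - s) by ring.
by apply: le_trans (normcB_le _ _) _; rewrite (splitr e) ltW // ltrD.
Qed.

Lemma series_to_has_sum b s : has_sum b s -> series_to b s.
Proof. by move=> bs e e0; exact: has_sum_nat_series. Qed.

Lemma series_to_bounded b s : series_to b s ->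
  exists2 M : R, 0 <= M & forall n, normc (b n) <= M.
Proof.
move=> bs; have [N hN] := bs _ ltr01.
exists (1 + 1 + \sum_(k < N) normc (b k)) => [|n].
  by rewrite !addr_ge0 ?sumr_ge0 // => *; rewrite normc_ge0.
have [nN|Nn] := ltnP n N.
  rewrite (bigD1 (Ordinal nN)) //= addrCA lerDl addr_ge0 //.
  by rewrite sumr_ge0 // => *; rewrite normc_ge0.
apply: le_trans (_ : 1 + 1 <= _); last by rewrite lerDl sumr_ge0 // => *; rewrite normc_ge0.
have h := hN _ Nn; have h' := hN n.+1 (leqW Nn).
have -> : b n = (\sum_(k < n.+1) b k - s) - (\sum_(k < n) b k - s) by rewrite big_ord_recr /=; ring.
by apply: le_trans (normcB_le _ _) _; rewrite lerD ?ltW.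
Qed.

Lemma bounded_power_abs_summable a t T M : (forall n, normc (a n * t ^+ n) <= M) ->
  normc T < normc t -> abs_summable (fun n => a n * T ^+ n).
Proof.
move=> aM Tt; have t0 : 0 < normc t by apply: le_lt_trans Tt; exact: normc_ge0.
have M0 : 0 <= M by apply: le_trans (aM 0%N); exact: normc_ge0.
pose q := normc T / normc t.
have q01 : 0 <= q < 1 by rewrite divr_ge0 ?normc_ge0 //= ltr_pdivrMr // mul1r.
apply: (abs_summable_nat (M := M * (1 - q)^-1 ^+ 1)) => n.
apply: le_trans (_ : \sum_(k < n) M * (rising_coef (1%:R : R) k * q ^+ k) <= _); last first.
  by rewrite -mulr_sumr ler_wpM2l // sum_rising_coef_le.
apply: ler_sum => k _; have -> : rising_coef (1%:R : R) k = 1.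
  rewrite /rising_coef fact_prod natr_prod big_add1 big_mkord /=.
  under eq_bigr do rewrite nat1r.
  by rewrite divff //; apply/prodf_neq0 => i _; rewrite pnatr_eq0.
have tk : t ^+ k != 0 by rewrite -normc_gt0 normcX exprn_gt0.
have -> : a k * T ^+ k = (a k * t ^+ k) * (T / t) ^+ k.
  by rewrite exprMn exprVn -mulrA [T ^+ k / _]mulrC mulVKf.
rewrite Normc.normcM mul1r normcX normc_div ler_wpM2r ?aM //.
by rewrite exprn_ge0 //; case/andP: q01.
Qed.

(** Abel's limit theorem, through the summation by parts
sum b_k x^k - s = D_n x^n + (1 - x) sum D_(k+1) x^k with D_n the n-th partial sum
minus s. *)
Lemma abel_limit b s (A : R -> R[i]) : series_to b s ->
  (forall x, 0 <= x < 1 -> has_sum (fun n => b n * x%:C ^+ n) (A x)) ->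
  left_lim1 A s.
Proof.
move=> bs bA e e0; have e4 : 0 < e / 4 by rewrite divr_gt0.
have [N hN] := bs _ e4; pose D n := \sum_(k < n) b k - s.
pose M := \sum_(k < N) normc (D k.+1).
have M0 : 0 <= M by rewrite sumr_ge0 // => *; rewrite normc_ge0.
exists (e / 4 / (M + 1)) => [|x /andP[xd x1] x0]; first by rewrite divr_gt0 // ltr_wpDl.
have Mx : (1 - x) * M <= e / 4.
  have := ltr_wpDl M0 ltr01 => M1.
  have : 1 - x < e / 4 / (M + 1) by lra.
  rewrite ltr_pdivlMr // => /ltW; apply: le_trans.
  by rewrite ler_wpM2l ?lerDl // subr_ge0 ltW.
have nx : normc x%:C = x by rewrite normc_real ger0_norm.
have summation n : \sum_(k < n) b k * x%:C ^+ k - s =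
    D n * x%:C ^+ n + (1 - x)%:C * \sum_(k < n) D k.+1 * x%:C ^+ k.
  elim: n => [|n IH]; first by rewrite /D !big_ord0 expr0; ring.
  have -> : \sum_(k < n.+1) b k * x%:C ^+ k - s =
     (\sum_(k < n) b k * x%:C ^+ k - s) + b n * x%:C ^+ n by rewrite big_ord_recr /=; ring.
  rewrite IH [in RHS]big_ord_recr /= [in RHS]mulrDr.
  have -> : b n = D n.+1 - D n by rewrite /D big_ord_recr /=; ring.
  by rewrite exprS rmorphB /=; ring.
have geom n : (1 - x) * \sum_(k < n) x ^+ k <= 1.
  by rewrite -opprB mulNr -subrX1 opprB gerBl exprn_ge0.
have D_le k : normc (D k.+1) <= (if (k < N)%N then normc (D k.+1) else 0) + e / 4.
  case: ltnP => kN; first by rewrite lerDl ltW.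
  by rewrite add0r ltW // hN // leqW.
have partial n : (N <= n)%N -> normc (\sum_(k < n) b k * x%:C ^+ k - s) <= e / 4 + (e / 4 + e / 4).
  move=> Nn; rewrite summation; apply: le_trans (normcD_le _ _) _; apply: lerD.
    rewrite Normc.normcM normcX nx -[leRHS]mulr1 ler_pM ?normc_ge0 ?exprn_ge0 //.
      by rewrite ltW // hN.
    by rewrite exprn_ile1 // ltW.
  rewrite Normc.normcM normc_real ger0_norm ?subr_ge0 ?(ltW x1) //.
  apply: le_trans (_ : (1 - x) * (M + \sum_(k < n) e / 4 * x ^+ k) <= _).
    rewrite ler_wpM2l ?subr_ge0 ?(ltW x1) //; apply: le_trans (normc_sum_le _ _ _) _.
    have -> : M = \sum_(k < n) (if (k < N)%N then normc (D k.+1) else 0).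
      by rewrite /M (big_ord_widen n (fun k => normc (D k.+1))) // big_mkcond.
    rewrite -big_split /=.
    apply: ler_sum => k _; rewrite Normc.normcM normcX nx.
    apply: le_trans (ler_wpM2r (exprn_ge0 _ x0) (D_le k)) _.
    rewrite mulrDl lerD2r; case: ifP => _; last by rewrite mul0r.
    by rewrite -[leRHS]mulr1 ler_wpM2l ?normc_ge0 // exprn_ile1 // ltW.
  rewrite mulrDr lerD // -mulr_sumr mulrCA -[leRHS]mulr1.
  by rewrite ler_wpM2l // ltW.
have x01 : 0 <= x < 1 by rewrite x0.
have [N' hN'] := has_sum_nat_series (bA x x01) e4.
have := hN' _ (leq_maxr N N'); have := partial _ (leq_maxl N N').
set S := \sum_(k < _) _ => h1 h2.
have -> : A x - s = (S - s) - (S - A x) by ring.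
by apply: le_lt_trans (normcB_le _ _) _; move: h1 h2; lra.
Qed.

Lemma left_lim1_unique g s s' : left_lim1 g s -> left_lim1 g s' -> s = s'.
Proof.
move=> gs gs'; apply/eqP; rewrite -subr_eq0; apply/eqP/normc_small_eq0 => e e0.
have [d d0 hd] := gs _ (divr2_gt0 e0); have [d' d'0 hd'] := gs' _ (divr2_gt0 e0).
pose m := Num.min (1 / 2) (Num.min (d / 2) (d' / 2)).
have m0 : 0 < m by rewrite !lt_min !divr_gt0.
have m1 : m <= 1 / 2 by rewrite ge_min lexx.
have md : m <= d / 2 by rewrite !ge_min lexx !orbT.
have md' : m <= d' / 2 by rewrite !ge_min lexx !orbT.
have := hd (1 - m) _ _; have := hd' (1 - m) _ _.
move=> h' h; have -> : s - s' = (g (1 - m) - s') - (g (1 - m) - s) by ring.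
apply: le_trans (normcB_le _ _) _; rewrite (splitr e) ltW // ltrD //.
  by apply: h'; [apply/andP; split|]; lra.
by apply: h; [apply/andP; split|]; lra.
Qed.

Lemma left_lim1M g h s s' : left_lim1 g s -> left_lim1 h s' ->
  left_lim1 (fun x => g x * h x) (s * s').
Proof.
move=> gs hs e e0.
have k0 : 0 < normc s + 1 by rewrite ltr_wpDl ?normc_ge0.
have k'0 : 0 < normc s' + 1 by rewrite ltr_wpDl ?normc_ge0.
pose e1 := Num.min 1 (e / 2 / (normc s' + 1)); pose e2 := e / 2 / (normc s + 1).
have e10 : 0 < e1 by rewrite lt_min ltr01 !divr_gt0.
have [d d0 hd] := gs _ e10; have [d' d'0 hd'] := hs e2 (divr_gt0 (divr2_gt0 e0) k0).
exists (Num.min d d') => [|x /andP[xd x1] x0]; first by rewrite lt_min d0.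
have le_d : Num.min d d' <= d by rewrite ge_min lexx.
have le_d' : Num.min d d' <= d' by rewrite ge_min lexx orbT.
have := hd x _ x0; have := hd' x _ x0; rewrite x1 andbT.
move=> /(_ ltac:(lra)) h2; rewrite andbT => /(_ ltac:(lra)); rewrite lt_min => /andP[h1 h1'].
have -> : g x * h x - s * s' = g x * (h x - s') + (g x - s) * s' by ring.
apply: le_lt_trans (normcD_le _ _) _; rewrite !Normc.normcM (splitr e) ler_ltD //.
  apply: le_trans (_ : (normc s + 1) * e2 <= _); last by rewrite mulrC divfK // gt_eqF.
  rewrite ler_pM ?normc_ge0 ?(ltW h2) //.
  have -> : g x = s + (g x - s) by ring.
  by apply: le_trans (normcD_le _ _) _; rewrite lerD2l ltW.
move: h1'; rewrite ltr_pdivlMr //; apply: le_lt_trans.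
by rewrite ler_wpM2l ?normc_ge0 // lerDl.
Qed.

(** With t = p + i q the claim amounts to x |1 - t| < |1 - x t|, and
|1 - x t|^2 - x^2 |1 - t|^2 = (1 - x)^2 + 2 x (1 - x) (1 - p), which is positive
because p < 1. *)
Lemma euler_map_ray_lt t x : normc t < 1 -> t != 0 -> 0 <= x < 1 ->
  normc (euler_map (x%:C * t)) < normc (euler_map t).
Proof.
move=> t1 t0 /andP[x0 x1]; have nt : 0 < normc t by rewrite normc_gt0.
have xt1 : normc (x%:C * t) < 1.
  rewrite Normc.normcM normc_real ger0_norm //; apply: le_lt_trans t1.
  by rewrite ler_piMl ?normc_ge0 // ltW.
have p1 : complex.Re t < 1.
  by apply: le_lt_trans t1; apply: le_trans (normr_Re_le t); exact: ler_norm.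
rewrite /euler_map !normc_div !normc_opp Normc.normcM normc_real ger0_norm //.
rewrite ltr_pdivrMr ?normc_gt0 ?normc_lt1_neq0 // mulrAC ltr_pdivlMr ?normc_gt0 ?normc_lt1_neq0 //.
rewrite [x * _]mulrC -mulrA ltr_pM2l //.
have -> : x * normc (1 - t) = normc (x%:C * (1 - t)) by rewrite Normc.normcM normc_real ger0_norm.
case: t p1 {t1 t0 nt xt1} => p q /= p1; rewrite ltr_sqrt.
  rewrite -subr_gt0; apply: lt_le_trans (_ : (1 - x) * (1 - x) <= _).
    by rewrite mulr_gt0 // subr_gt0.
  have : 0 <= (1 - x) * (2 * x * (1 - p)) by rewrite !mulr_ge0 ?subr_ge0 ?(ltW x1) ?(ltW p1).
  by move: x0; lra.
have : (x * p) < 1 by apply: le_lt_trans (_ : x < 1); nra.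
move=> h; apply: ltr_pwDl; last exact: sqr_ge0.
by rewrite exprn_even_gt0 //= !mul0r subr0 gt_eqF // subr_gt0.
Qed.

Lemma left_lim1_power_series c (r : R) F (z : R -> R[i]) z1 : power_series_on c r F ->
  normc z1 <= r -> (forall x, 0 <= x < 1 -> normc (z x) <= r) -> left_lim1 z z1 ->
  left_lim1 (F \o z) (F z1).
Proof.
move=> cF z1r zr zz1 e e0; have r0 : 0 <= r by apply: le_trans z1r; exact: normc_ge0.
have [d d0 hd] := power_series_on_continuous r0 cF e0.
have [d' d'0 hd'] := zz1 d d0; exists d' => // x xd x0.
apply: hd => //; last exact: hd'.
by apply: zr; rewrite x0; case/andP: xd.
Qed.

Lemma left_lim1_ray t : left_lim1 (fun x => x%:C * t) t.
Proof.
move=> e e0; have k0 : 0 < normc t + 1 by rewrite ltr_wpDl ?normc_ge0.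
exists (e / (normc t + 1)) => [|x /andP[xd x1] _]; first by rewrite divr_gt0.
have -> : x%:C * t - t = - ((1 - x)%:C * t) by rewrite rmorphB /=; ring.
rewrite normc_opp Normc.normcM normc_real ger0_norm ?subr_ge0 ?(ltW x1) //.
have : 1 - x < e / (normc t + 1) by lra.
rewrite ltr_pdivlMr //; apply: le_lt_trans.
by rewrite ler_wpM2l ?subr_ge0 ?(ltW x1) // lerDl.
Qed.

Lemma left_lim1_euler_map t : normc t < 1 ->
  left_lim1 (fun x => euler_map (x%:C * t)) (euler_map t).
Proof.
move=> t1; have y0 : 0 < 1 - normc t by rewrite subr_gt0.
move=> e e0; have [d d0 hd] := left_lim1_ray t (mulr_gt0 e0 (mulr_gt0 y0 y0)).
exists d => // x xd x0; have /andP[_ x1] := xd.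
have xt : normc (x%:C * t) <= normc t.
  by rewrite Normc.normcM normc_real ger0_norm // ler_piMl ?normc_ge0 // ltW.
have xt1 := le_lt_trans xt t1.
have n1 := normc_lt1_neq0 t1; have n2 := normc_lt1_neq0 xt1.
have -> : euler_map (x%:C * t) - euler_map t = - (x%:C * t - t) / ((1 - t) * (1 - x%:C * t)).
  by rewrite /euler_map; field; rewrite n1 n2.
rewrite normc_div normc_opp Normc.normcM ltr_pdivrMr ?mulr_gt0 ?normc_gt0 //.
apply: lt_le_trans (hd x xd x0) _; rewrite ler_wpM2l ?(ltW e0) //.
rewrite ler_pM ?(ltW y0) ?normc_1sub_ge //.
by apply: le_trans (normc_1sub_ge _); rewrite lerD2l lerN2.
Qed.

(** Both sides are only assumed to converge at t itself; the proof joins 0, where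
euler_transform applies, to t. *)
Theorem euler_summation lambda e t s f : normc t < 1 ->
  series_to (fun n => euler_coef lambda e n * t ^+ n) s ->
  has_sum (fun N => e N * euler_map t ^+ N) f ->
  s = binomial_sum lambda t * f.
Proof.
move=> t1 as_ ef; set a := euler_coef lambda e in as_.
have [t0|t0] := eqVneq t 0.
  apply: series_to_unique as_ (series_to_has_sum _).
  apply: euler_transform => //; move: (has_sum_abs_summable ef).
  by rewrite t0 /euler_map oppr0 Normc.normc0 !mul0r.
have nt : 0 < normc t by rewrite normc_gt0.
pose r := normc (euler_map t).
have r0 : 0 < r by rewrite normc_gt0 mulf_neq0 ?oppr_eq0 ?invr_neq0 ?normc_lt1_neq0.
pose A T := hsum (fun n => a n * T ^+ n).
pose B T := binomial_sum lambda T.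
pose F z := hsum (fun N => e N * z ^+ N).
have eF : power_series_on e r F.
  by move=> z zr; apply: hsumP; apply: abs_summable_power_le zr (has_sum_abs_summable ef).
have [M _ aM] := series_to_bounded as_.
have aA T : normc T < normc t -> has_sum (fun n => a n * T ^+ n) (A T).
  by move=> Tt; apply: hsumP; exact: bounded_power_abs_summable aM Tt.
have cB : power_series_on (rising_coef lambda) (normc t) B.
  by move=> z zt; apply: binomial_has_sum; exact: le_lt_trans t1.
have xt x : 0 <= x < 1 -> normc (x%:C * t) < normc t.
  by move=> /andP[x0 x1]; rewrite Normc.normcM normc_real ger0_norm // gtr_pMl.
have key x : 0 <= x < 1 -> A (x%:C * t) = B (x%:C * t) * F (euler_map (x%:C * t)).
  move=> x01; apply/eqP; rewrite -subr_eq0; apply/eqP.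
  pose u T := A T - B T * F (euler_map T).
  apply: (@analytic_ray_identity _ u t (Num.min (normc t / 2) (Num.min (1 / 2) (r / 2)))) x01 => //.
  - by rewrite !lt_min !divr_gt0.
  - move=> T; rewrite !le_min => /andP[Tt /andP[T12 Tr]].
    have T0 := normc_ge0 T; have T1 : normc T < 1 by lra.
    apply/eqP; rewrite subr_eq0; apply/eqP/hsumE; apply: euler_transform => //.
      have : abs_summable (fun N => e N * euler_map t ^+ N) by exact: has_sum_abs_summable ef.
      apply: abs_summable_power_le; rewrite normc_real ger0_norm ?divr_ge0 ?subr_ge0 ?(ltW T1) //.
      rewrite ler_pdivrMr ?subr_gt0 // -/r; move: Tr T12 r0; nra.
    apply: eF; apply: le_trans (normc_euler_map_le T1) _.
    by rewrite ler_pdivrMr ?subr_gt0 //; move: Tr T12 r0; nra.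
  move=> y y01; have yt := xt _ y01; apply: analytic_atB.
    (* A radius strictly between |y t| and |t|. *)
    pose m := (normc (y%:C * t) + normc t) / 2.
    apply: (@power_series_on_analytic_at _ a m); last by rewrite /m; lra.
    by move=> z zm; apply: aA; apply: le_lt_trans zm _; rewrite /m; lra.
  apply: analytic_atM; first exact: power_series_on_analytic_at cB yt.
  apply: (@analytic_at_euler_map _ F).
    by rewrite eq_sym -subr_eq0 normc_lt1_neq0 // (lt_trans yt).
  by apply: power_series_on_analytic_at eF _; exact: euler_map_ray_lt.
have limA : left_lim1 (fun x => A (x%:C * t)) s.
  apply: abel_limit as_ _ => x x01; have := aA _ (xt x x01).
  by congr has_sum; apply/funext => n; rewrite exprMn; ring.
have limB : left_lim1 (fun x => B (x%:C * t)) (B t).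
  apply: (left_lim1_power_series cB) (left_lim1_ray t) => // x x01.
  exact: ltW (xt x x01).
have limF : left_lim1 (fun x => F (euler_map (x%:C * t))) f.
  have <- : F (euler_map t) = f by exact: hsumE.
  apply: (left_lim1_power_series eF) (left_lim1_euler_map t1) => // x x01.
  by rewrite ltW // euler_map_ray_lt.
apply: left_lim1_unique limA _ => d d0.
have [d' d'0 hd'] := left_lim1M limB limF d0; exists d' => // x xd x0.
by rewrite key ?hd' // x0; case/andP: xd.
Qed.

End AbelAndEulerSummation.
(** * Principal logarithm and powers *)

Section ComplexPowers.
Context {R : realType}.
Implicit Types (z w t lambda : R[i]) (x : R).
Local Notation normc := (@Normc.normc R).
Local Notation Re := (@complex.Re R).
Local Notation Im := (@complex.Im R).

Lemma cexpD z w : cexp (z + w) = cexp z * cexp w.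
Proof.
case: z w => a b [c d]; rewrite /cexp /= expRD cosD sinD.
by rewrite -!complexr0; simpc; congr (_ +i* _); ring.
Qed.

Lemma cexp0 : cexp (0 : R[i]) = 1.
Proof. by rewrite /cexp /= expR0 cos0 sin0 mul1r. Qed.

Lemma cexp_natmul n z : cexp (n%:R * z) = cexp z ^+ n.
Proof.
elim: n => [|n IH]; first by rewrite mul0r cexp0 expr0.
by rewrite -nat1r mulrDl mul1r cexpD IH exprS.
Qed.

Lemma normc_sqr z : normc z ^+ 2 = Re z ^+ 2 + Im z ^+ 2.
Proof. by case: z => a b /=; rewrite sqr_sqrtr // addr_ge0 ?sqr_ge0. Qed.

Lemma Re_div_normc z : -1 <= Re z / normc z <= 1.
Proof.
rewrite -ler_norml normrM normfV (ger0_norm (normc_ge0 z)).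
have [->|z0] := eqVneq z 0; first by rewrite normr0 mul0r.
by rewrite ler_pdivrMr ?normc_gt0 // mul1r normr_Re_le.
Qed.

Lemma cexp_cln z : z != 0 -> cexp (cln z) = z.
Proof.
move=> z0; have nz : 0 < normc z by rewrite normc_gt0.
have sinE : sin (acos (Re z / normc z)) = `|Im z| / normc z.
  rewrite sin_acos ?Re_div_normc // -[RHS]ger0_norm ?divr_ge0 ?normc_ge0 // -sqrtr_sqr.
  congr (Num.sqrt _); rewrite !expr_div_n real_normK ?num_real // normc_sqr.
  have := normc_sqr z; have := exprn_gt0 2 nz => n2 E.
  by field; rewrite -E gt_eqF.
have cosE : cos (acos (Re z / normc z)) = Re z / normc z.
  by rewrite acosK // in_itv /= Re_div_normc.
rewrite /cexp /cln /= lnK ?posrE // /carg.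
have -> : cos (if 0 <= Im z then acos (Re z / normc z) else - acos (Re z / normc z))
   = Re z / normc z by case: ifP; rewrite ?cosN.
have -> : sin (if 0 <= Im z then acos (Re z / normc z) else - acos (Re z / normc z))
   = Im z / normc z.
  case: leP => s; rewrite ?sinN sinE; first by rewrite ger0_norm.
  by rewrite ltr0_norm // mulNr opprK.
rewrite -complexr0; simpc.
by rewrite ![normc z * _]mulrC !divfK ?gt_eqF //; case: (z).
Qed.

Lemma cpow_nat z n : cpow z (n%:R : R)%:C = z ^+ n.
Proof.
rewrite /cpow rmorph_nat; case: eqP => [->|/eqP z0].
  by rewrite pnatr_eq0 expr0n.
by rewrite cexp_natmul cexp_cln.
Qed.

(** In the right half-plane the argument is an arc tangent, which is easier to
differentiate than the two branches of the arc cosine defining carg. *)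
Lemma cln_right_half_plane z : 0 < Re z ->
  cln z = (ln (Re z ^+ 2 + Im z ^+ 2) / 2) +i* atan (Im z / Re z).
Proof.
move=> z0; have nz : 0 < normc z.
  by rewrite normc_gt0; apply: contraTneq z0 => ->; rewrite ltxx.
rewrite /cln; congr (_ +i* _).
  by rewrite -normc_sqr lnXn // -[ln _ *+ 2]mulr_natr mulfK.
have ang : Re z / normc z = cos (atan (Im z / Re z)).
  rewrite cos_atan; have -> : 1 + (Im z / Re z) ^+ 2 = (normc z / Re z) ^+ 2.
    by rewrite !expr_div_n normc_sqr; field; rewrite gt_eqF.
  by rewrite sqrtr_sqr ger0_norm ?divr_ge0 ?ltW // invf_div.
have pi0 := pi_gt0 R.
have := atan_ltpi2 (Im z / Re z); have := atan_gtNpi2 (Im z / Re z) => lb ub.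
rewrite /carg ang; case: leP => s.
  rewrite cosK // in_itv /=; apply/andP; split; last by lra.
  by rewrite -(atan0 R) le_atan // divr_ge0 // ltW.
rewrite cosKN ?opprK //; apply/andP; split; first by lra.
rewrite -(atan0 R) le_atan // pmulr_lle0 ?invr_gt0 //; exact: ltW.
Qed.

End ComplexPowers.

(** * The binomial theorem for principal powers *)

Section BinomialTheorem.
Context {R : realType}.
Implicit Types (z w t lambda mu : R[i]) (x : R) (f g : R -> R[i]).
Local Notation normc := (@Normc.normc R).
Local Notation Re := (@complex.Re R).
Local Notation Im := (@complex.Im R).

Definition complex_derive f x z :=
  is_derive x (1 : R) (fun y : R => Re (f y)) (Re z) /\
  is_derive x (1 : R) (fun y : R => Im (f y)) (Im z).

Lemma complex_derive_eq f g x z w : f =1 g -> z = w ->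
  complex_derive f x z -> complex_derive g x w.
Proof. by move=> /funext -> ->. Qed.

Lemma ReM z w : Re (z * w) = Re z * Re w - Im z * Im w.
Proof. by case: z w => a b []. Qed.

Lemma ImM z w : Im (z * w) = Re z * Im w + Im z * Re w.
Proof. by case: z w => a b []. Qed.

Lemma ReD z w : Re (z + w) = Re z + Re w.
Proof. by case: z w => a b []. Qed.

Lemma ImD z w : Im (z + w) = Im z + Im w.
Proof. by case: z w => a b []. Qed.

Lemma complex_deriveM f g x z w :
  complex_derive f x z -> complex_derive g x w ->
  complex_derive (fun y => f y * g y) x (f x * w + z * g x).
Proof.
move=> [f1 f2] [g1 g2]; split.
- have -> : (fun y : R => Re (f y * g y)) = (fun y => Re (f y)) * (fun y => Re (g y))
     - (fun y => Im (f y)) * (fun y => Im (g y)) :> (R -> R).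
    by apply/funext => y; rewrite ReM.
  apply: is_derive_eq; rewrite !ReD !ReM /GRing.scale /=; ring.
- have -> : (fun y : R => Im (f y * g y)) = (fun y => Re (f y)) * (fun y => Im (g y))
     + (fun y => Im (f y)) * (fun y => Re (g y)) :> (R -> R).
    by apply/funext => y; rewrite ImM.
  apply: is_derive_eq; rewrite !ImD !ImM /GRing.scale /=; ring.
Qed.

Lemma complex_derive_cexp f x z : complex_derive f x z ->
  complex_derive (fun y => cexp (f y)) x (z * cexp (f x)).
Proof.
move=> [f1 f2].
have expE w : Re (cexp w) = expR (Re w) * cos (Im w) /\ Im (cexp w) = expR (Re w) * sin (Im w).
  by rewrite /cexp ReM ImM /= !mul0r subr0 addr0.
split.
- have -> : (fun y : R => Re (cexp (f y))) =
      (expR \o (fun y => Re (f y))) * (cos \o (fun y => Im (f y))) :> (R -> R).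
    by apply/funext => y; rewrite (expE _).1.
  have d1 := is_derive1_comp (is_derive_expR (Re (f x))) f1.
  have d2 := is_derive1_comp (is_derive_cos (Im (f x))) f2.
  apply: is_derive_eq; rewrite ReM (expE _).1 (expE _).2 /GRing.scale /=; ring.
- have -> : (fun y : R => Im (cexp (f y))) =
      (expR \o (fun y => Re (f y))) * (sin \o (fun y => Im (f y))) :> (R -> R).
    by apply/funext => y; rewrite (expE _).2.
  have d1 := is_derive1_comp (is_derive_expR (Re (f x))) f1.
  have d2 := is_derive1_comp (is_derive_sin (Im (f x))) f2.
  apply: is_derive_eq; rewrite ImM (expE _).1 (expE _).2 /GRing.scale /=; ring.
Qed.

Lemma complex_derive_zero_constant f : (forall x, 0 <= x <= 1 -> complex_derive f x 0) ->
  f 1 = f 0.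
Proof.
move=> f0.
have real (h : R -> R) : (forall x, 0 <= x <= 1 -> is_derive x (1 : R) h 0) -> h 1 = h 0.
  move=> h0; have [] := @MVT R h (fun=> 0) 0 1 ltr01.
  - by move=> x /[!in_itv] /andP[x0 x1]; apply: h0; rewrite !ltW.
  - apply: derivable_within_continuous => x /[!in_itv] x01.
    by have [] := h0 x x01.
  - by move=> c _; rewrite mul0r => /eqP; rewrite subr_eq0 => /eqP.
apply/eqP; rewrite eq_complex; apply/andP; split; apply/eqP.
  by apply: (real (fun y => Re (f y))) => x /f0[].
by apply: (real (fun y => Im (f y))) => x /f0[].
Qed.

Lemma rising_coef_diff mu n :
  n.+1%:R * rising_coef mu n.+1 = mu * rising_coef (mu + 1) n.
Proof.
rewrite /rising_coef rising_prod_recl factS natrM.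
have n0 : (n.+1%:R : R[i]) != 0 by rewrite pnatr_eq0.
have f0 : (n`!%:R : R[i]) != 0 by rewrite pnatr_eq0 -lt0n fact_gt0.
by field; rewrite -[1 + n%:R]/(1%:R + n%:R) -natrD add1n n0 f0.
Qed.

Lemma series_to_Re_cvg (b : nat -> R[i]) s : series_to b s ->
  (series (fun n => Re (b n)) : nat -> R) @ \oo --> Re s.
Proof.
move=> bs; apply/cvgrPdist_lt => e e0; have [N hN] := bs e e0.
exists N => // n /= Nn; apply: le_lt_trans (hN n Nn).
rewrite /series /= big_mkord -Re_sum normcB_sym; apply: le_trans (normr_Re_le _).
by case: (s) (\sum_(k < n) b k) => ? ? [].
Qed.

Let binomial_pseries_cvg mu t (c : R[i]) (x : R) : normc (x%:C * t) < 1 ->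
  pseries (fun n => Re (c * (rising_coef mu n * t ^+ n))) x @ \oo
    --> Re (c * binomial_sum mu (x%:C * t)).
Proof.
move=> xt1; have := series_to_has_sum (has_sumZ c (binomial_has_sum mu xt1)).
move=> /series_to_Re_cvg; rewrite /pseries.
have -> // : (fun n => Re (c * (rising_coef mu n * t ^+ n)) * x ^+ n) =
  (fun n => Re (c * (rising_coef mu n * (x%:C * t) ^+ n))).
apply/funext => n.
rewrite exprMn -rmorphXn /=; set y := x ^+ n.
have -> : c * (rising_coef mu n * (y%:C * t ^+ n)) =
    y%:C * (c * (rising_coef mu n * t ^+ n)) by ring.
by rewrite [in RHS]ReM /= mul0r subr0 mulrC.
Qed.

Let binomial_pseries_diffs mu t c :
  pseries_diffs (fun n => Re (c * (rising_coef mu n * t ^+ n))) =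
  (fun n => Re (c * mu * t * (rising_coef (mu + 1) n * t ^+ n))).
Proof.
apply/funext => n; rewrite /pseries_diffs exprS.
have -> : c * mu * t * (rising_coef (mu + 1) n * t ^+ n) =
   (n.+1%:R : R)%:C * (c * (rising_coef mu n.+1 * (t * t ^+ n))).
  rewrite rmorph_nat; have := rising_coef_diff mu n => E.
  have -> : n.+1%:R * (c * (rising_coef mu n.+1 * (t * t ^+ n))) =
    c * (n.+1%:R * rising_coef mu n.+1) * (t * t ^+ n) by ring.
  by rewrite E; ring.
by rewrite [in RHS]ReM /= mul0r subr0.
Qed.

(** The real and imaginary parts of the binomial series on the segment are real
power series, to which termwise differentiation applies: n+1 times the
coefficient of order n+1 for lambda is lambda times that of order n for
lambda + 1. The function f given by the limits of these real series agrees with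
the binomial sum only for 0 <= x <= 1, whence the existential statement. *)
Lemma binomial_sum_complex_derive lambda t : normc t < 1 -> exists f : R -> R[i],
  forall x, 0 <= x <= 1 -> f x = binomial_sum lambda (x%:C * t) /\
    complex_derive f x (lambda * t * binomial_sum (lambda + 1) (x%:C * t)).
Proof.
move=> t1; pose g c x := limn (pseries (fun n => Re (c * (rising_coef lambda n * t ^+ n))) x).
have xt x : 0 <= x <= 1 -> normc (x%:C * t) < 1.
  move=> /andP[x0 x1]; rewrite Normc.normcM normc_real ger0_norm //.
  by apply: le_lt_trans t1; rewrite ler_piMl ?normc_ge0.
(* K is a point with 1 < K and K |t| < 1, so that the real series converge beyond [0, 1]. *)
pose K := 2 / (1 + normc t); have nt := normc_ge0 t.
have K0 : 0 <= K by rewrite divr_ge0 // addr_ge0.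
have K1 : 1 < K by rewrite ltr_pdivlMr ?mul1r; lra.
have Kt : normc (K%:C * t) < 1.
  rewrite Normc.normcM normc_real ger0_norm // mulrAC ltr_pdivrMr; lra.
have gE c x : 0 <= x <= 1 -> g c x = Re (c * binomial_sum lambda (x%:C * t)).
  by move=> x01; apply/cvg_lim => //; apply: binomial_pseries_cvg; exact: xt.
have cvgK mu c : cvgn (pseries (fun n => Re (c * (rising_coef mu n * t ^+ n))) K).
  by apply/cvg_ex; eexists; exact: binomial_pseries_cvg Kt.
have dg c x : 0 <= x <= 1 -> is_derive x (1 : R) (g c)
    (Re (c * (lambda * t * binomial_sum (lambda + 1) (x%:C * t)))).
  move=> x01.
  have := @pseries_snd_diffs R (fun n => Re (c * (rising_coef lambda n * t ^+ n))) K x.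
  rewrite !binomial_pseries_diffs !mulrA => H.
  have := H (cvgK _ _) (cvgK _ _) (cvgK _ _) _.
  rewrite (cvg_lim _ (@binomial_pseries_cvg (lambda + 1) t (c * lambda * t) x (xt x x01))) //; apply.
  have /andP[x0 x1] := x01; rewrite !ger0_norm //; exact: le_lt_trans x1 K1.
(* Multiplying by -i moves the imaginary part to the real part. *)
exists (fun x => g 1 x +i* g (- 'i) x) => x x01.
have ImE z : Re (- 'i * z) = Im z by case: z => a b; rewrite ReM /=; ring.
split; first by rewrite !gE // mul1r ImE; case: binomial_sum.
by split => /=; [have := dg 1 x x01; rewrite mul1r|have := dg (- 'i) x x01; rewrite ImE].
Qed.

(** Since the modulus of t is less than 1, the segment from 1 to 1 - t lies in the
right half-plane, where log (1 - x t) has the smooth expression of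
cln_right_half_plane. *)
Lemma cln_ray_complex_derive t : normc t < 1 -> exists f : R -> R[i],
  [/\ f 0 = 0, f 1 = cln (1 - t) & forall x, 0 <= x <= 1 ->
    complex_derive f x (- t / (1 - x%:C * t))].
Proof.
case: t => p q t1.
have p1 : p < 1.
  by apply: le_lt_trans t1; apply: le_trans (normr_Re_le (p +i* q)); exact: ler_norm.
pose re (x : R) : R := 1 - x * p; pose im (x : R) : R := - (x * q).
pose D x := re x ^+ 2 + im x ^+ 2.
exists (fun x => (ln (D x) / 2) +i* atan (im x / re x)); split.
- by rewrite /D /re /im !mul0r subr0 oppr0 mul0r expr1n expr0n addr0 ln1 atan0 mul0r.
- rewrite cln_right_half_plane.
    by rewrite /D /re /im /= !mul1r !sub0r.
  by rewrite /= subr_gt0.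
move=> x /andP[x0 x1].
have re0 : 0 < re x.
  have [->|xn0] := eqVneq x 0; first by rewrite /re mul0r subr0.
  have : 0 < x * (1 - p) by rewrite mulr_gt0 ?subr_gt0 // lt_def xn0.
  by rewrite /re; move: x1; lra.
have D0 : 0 < D x by rewrite /D ltr_pwDl ?sqr_ge0 // exprn_gt0.
have dre : is_derive x (1 : R) re (- p).
  have -> : re = cst 1 - (p \*: id) by apply/funext => y; rewrite /re /= mulrC.
  by apply: is_derive_eq; rewrite /GRing.scale /= mulr1 sub0r.
have dim : is_derive x (1 : R) im (- q).
  have -> : im = - (q \*: id) by apply/funext => y; rewrite /im /= mulrC.
  by apply: is_derive_eq; rewrite /GRing.scale /= mulr1.
have dD : is_derive x (1 : R) D (- 2 * (p * re x + q * im x)).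
  have -> : D = re * re + im * im by apply/funext => y; rewrite /D !expr2.
  by apply: is_derive_eq; rewrite /GRing.scale /=; ring.
have inv : - (p +i* q) / (1 - x%:C * (p +i* q)) =
   ((- (p * re x + q * im x)) / D x) +i* (- q / D x).
  have n0 : 1 - x%:C * (p +i* q) != 0.
    apply: contraTneq re0 => /(congr1 (@complex.Re R)) /=.
    by rewrite mul0r subr0 /re => ->; rewrite ltxx.
  apply: (mulIf n0); rewrite divfK //.
  have D00 : D x != 0 by rewrite gt_eqF.
  rewrite -complexr0; simpc; congr (_ +i* _); move: D00; rewrite /D /re /im => D00; field => //.
rewrite inv; split => /=.
  have -> : (fun y : R => ln (D y) / 2) = (2^-1 \*: (@ln R \o D)) :> (R -> R).
    by apply/funext => y /=; rewrite mulrC.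
  have dl := is_derive1_comp (is_derive1_ln D0) dD.
  by apply: is_derive_eq; rewrite /GRing.scale /=; field; rewrite gt_eqF.
have dv : is_derive x (1 : R) (fun y => im y / re y) (- q / re x ^+ 2).
  have dr : is_derive x (1 : R) (fun y => (re y)^-1) _ := is_deriveV (lt0r_neq0 re0) dre.
  have -> : (fun y => im y / re y) = im * (fun y => (re y)^-1) :> (R -> R) by [].
  by apply: is_derive_eq; rewrite /GRing.scale /= /re /im; field; rewrite gt_eqF.
have da := @is_derive1_comp R (@atan R) (fun y => im y / re y) x _ _ (is_derive1_atan _) dv.
apply: is_derive_eq da _; rewrite /D; field.
by rewrite !gt_eqF.
Qed.

(** With B the binomial sum, B' = lambda t B / (1 - x t) along the segment, so that
B exp (lambda log (1 - x t)) is constant. *)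
Theorem binomial_sum_cpow lambda t : normc t < 1 ->
  binomial_sum lambda t = cpow (1 - t) (- lambda).
Proof.
move=> t1; have [B BP] := binomial_sum_complex_derive lambda t1.
have [l [l0 l1 lP]] := cln_ray_complex_derive t1.
have [B1 _] := BP 1 ltac:(by rewrite ler01 lexx).
have [B0 _] := BP 0 ltac:(by rewrite ler01 lexx).
pose u x := B x * cexp (lambda * l x).
have u0 x : 0 <= x <= 1 -> complex_derive u x 0.
  move=> x01; have [Bx dB] := BP x x01; have dl := lP x x01.
  have xt1 : normc (x%:C * t) < 1.
    have /andP[x0 x1] := x01; rewrite Normc.normcM normc_real ger0_norm //.
    by apply: le_lt_trans t1; rewrite ler_piMl ?normc_ge0.
  have n0 := normc_lt1_neq0 xt1.
  have dc : complex_derive (fun=> lambda) x 0 by split; exact: is_derive_cst.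
  apply: complex_derive_eq (complex_deriveM dB (complex_derive_cexp (complex_deriveM dc dl))) => //.
  by rewrite Bx -(binomial_sum_succ lambda xt1); field.
have := complex_derive_zero_constant u0.
rewrite /u l0 l1 mulr0 cexp0 mulr1 B1 B0 mul1r mul0r => E.
have -> : cpow (1 - t) (- lambda) = cexp (- (lambda * cln (1 - t))).
  by rewrite /cpow (negbTE (normc_lt1_neq0 t1)) mulNr.
have E0 : binomial_sum lambda 0 = 1.
  apply: hsumE; have := @has_sum_nat_finite _ (fun n => rising_coef lambda n * 0 ^+ n) 1.
  by rewrite big_ord1 rising_coef0 mulr1; apply => -[//|n] _; rewrite exprS mul0r mulr0.
rewrite E0 in E; set z := lambda * cln (1 - t) in E *.
have cexpK : cexp z * cexp (- z) = 1 by rewrite -cexpD subrr cexp0.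
by rewrite -[LHS]mulr1 -[X in _ * X]cexpK mulrA E mul1r.
Qed.

End BinomialTheorem.
(** * Grouping a multiple series by degree *)

Section Grouping.
Context {R : realType}.
Implicit Types (z w t lambda : R[i]) (x : R).
Local Notation normc := (@Normc.normc R).

(** The library norm of a complex number is itself complex; this is the passage to
the real modulus. *)
Lemma near_norm_normc {T : Type} {F : set_system T} {FF : Filter F} (f : T -> R[i]) s :
  (f : T -> R[i]^o) @ F --> (s : R[i]^o) ->
  forall e : R, 0 < e -> \forall x \near F, normc (f x - s) < e.
Proof.
move=> /cvgrPdist_lt fs e e0; have eC : 0 < e%:C by rewrite ltcR.
by have := fs _ eC; apply: filterS => x; rewrite ltcR normcB_sym.
Qed.

Lemma cvg_partial_sum_has_sum {I : choiceType} (f : I -> R[i]) :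
  cvg (partial_sum (f : I -> R[i]^o) @ totally) ->
  has_sum f (summability.sum (f : I -> R[i]^o)).
Proof.
move=> /(@near_norm_normc _ totally (@filter_filter _ _ totally_filter)) H e e0.
have [A _ hA] := H e e0; exists A => B AB.
by have := hA B AB; rewrite /partial_sum /= big_seq_fsetE.
Qed.

Lemma cvgn_series_to (b : nat -> R[i]) : cvgn (series b : nat -> R[i]^o) ->
  series_to b (limn (series b : nat -> R[i]^o)).
Proof.
move=> /near_norm_normc H e e0; have [N _ hN] := H e e0; exists N => n Nn.
by have := hN n Nn; rewrite /series /= big_mkord.
Qed.

Lemma pochn_split lambda n m : (m <= n)%N ->
  pochn lambda n = pochn lambda m * pochn (lambda + m%:R) (n - m).
Proof.
move=> mn; rewrite /pochn -(big_mkord xpredT (fun j => lambda + j%:R)).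
rewrite (big_cat_nat (n := m)) //= big_mkord; congr (_ * _).
rewrite -{1}(add0n m) big_addn big_mkord; apply: eq_bigr => j _.
by rewrite natrD addrAC addrA.
Qed.

Lemma pochn_opp_nat_eq0 (n m : nat) : (n < m)%N -> pochn (- n%:R : R[i]) m = 0.
Proof. by move=> nm; rewrite /pochn (bigD1 (Ordinal nm)) //= addNr mul0r. Qed.

Lemma pochn_opp_nat (n m : nat) : (m <= n)%N ->
  pochn (- n%:R : R[i]) m = (-1) ^+ m * n`!%:R / (n - m)`!%:R.
Proof.
move=> mn; have f0 : ((n - m)`!%:R : R[i]) != 0 by rewrite pnatr_eq0 -lt0n fact_gt0.
apply: (mulIf f0); rewrite divfK // -(ffact_fact mn) natrM mulrA; congr (_ * _).
rewrite ffact_prod natr_prod -[X in (-1) ^+ X]card_ord -prodr_const -big_split /=.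
apply: eq_bigr => j _; rewrite natrB ?(leq_trans (ltnW (ltn_ord j)) mn) //.
by rewrite mulN1r opprB addrC.
Qed.

(** The algebraic core: (lambda)_n / n! (-n)_N =
(-1)^N (lambda)_N (lambda + N)_(n - N) / (n - N)!. *)
Lemma euler_coef_pochn lambda (d : nat -> R[i]) n :
  euler_coef lambda (fun N => pochn lambda N * d N) n =
  pochn lambda n / n`!%:R * \sum_(N < n.+1) pochn (- n%:R) N * d N.
Proof.
rewrite /euler_coef mulr_sumr; apply: eq_bigr => N _.
have Nn : (N <= n)%N by rewrite -ltnS.
have f0 : (n`!%:R : R[i]) != 0 by rewrite pnatr_eq0 -lt0n fact_gt0.
have g0 : ((n - N)`!%:R : R[i]) != 0 by rewrite pnatr_eq0 -lt0n fact_gt0.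
rewrite (pochn_split lambda Nn) pochn_opp_nat // /rising_coef -/(pochn _ _).
by field; rewrite f0 g0.
Qed.

(** The fibre sums d N of c exist because some weighted family phi0 N (p i) c i is
summable with a nonzero weight on the fibre over N. They do not depend on the
weight, so the same d serves every summable family phi (p i) c i. *)
Lemma has_sum_group {I : choiceType} (p : I -> nat) (c : I -> R[i])
    (phi0 : nat -> nat -> R[i]) :
  (forall N, phi0 N N != 0) ->
  (forall N, abs_summable (fun i => phi0 N (p i) * c i)) ->
  exists d : nat -> R[i], forall (phi : nat -> R[i]) s,
    has_sum (fun i => phi (p i) * c i) s -> has_sum (fun N => phi N * d N) s.
Proof.
move=> phi0n abs0.
have slice N : exists d, has_sum (fun i => if p i == N then c i else 0) d.
  have [s sP] : exists s, has_sum (fun i => if p i == N then phi0 N (p i) * c i else 0) s.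
    apply: abs_summable_has_sum; apply: abs_summable_le (abs0 N) => i.
    by case: ifP => // _; rewrite Normc.normc0 normc_ge0.
  exists ((phi0 N N)^-1 * s); have := has_sumZ (phi0 N N)^-1 sP.
  congr has_sum; apply/funext => i; case: eqP => [->|_]; last by rewrite mulr0.
  by rewrite mulKf.
have [d dP] := choice slice; exists d => phi s phis.
apply: (has_sum_fiber (p := p) phis) => N; have := has_sumZ (phi N) (dP N).
congr has_sum; apply/funext => i.
by case: eqP => [->|_] //; rewrite mulr0.
Qed.

End Grouping.

(** * The terms of the hypergeometric series *)

Section HypergeometricTerms.
Context {R : realType} (rho : R) (k r : nat).
Implicit Types (alpha : R[i]) (beta gamma x : 'I_r -> R[i]) (m : {ffun 'I_r -> nat}).

(** The parameter 0 is a pole, hence the Pochhammer symbols are defined only at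
natural indices. *)
Lemma E_defined_index_nat beta gamma x :
  E_defined rho k (- 0%:R) beta gamma x -> forall m, E_index rho k m \is a Num.nat.
Proof.
move=> def m; have [//|[pole]] := E_defined_pochhammer def m.
by case: pole; exists 0%N.
Qed.

(** rho is the index of the multi-index with a single 1 at i. *)
Lemma rho_nat (i : 'I_r) : (i < k)%N -> (forall m, E_index rho k m \is a Num.nat) ->
  rho \is a Num.nat.
Proof.
move=> ik nat_idx; have := nat_idx [ffun j => (j == i : nat)].
rewrite /E_index (bigD1 i) //= ffunE eqxx big1 => [|j /andP[_ /negbTE ji]]; last first.
  by rewrite ffunE ji.
rewrite big1 => [|j kj]; first by rewrite addn0 mulr1 addr0.
by rewrite ffunE; case: eqP kj => // ->; rewrite leqNgt ik.
Qed.

Definition E_coef beta gamma x m : R[i] :=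
  (\prod_(i < r | (k <= i)%N) pochn (beta i) (m i)) / \prod_(i < r) pochn (gamma i) (m i)
  * \prod_(i < r) (x i ^+ m i / (m i)`!%:R).

Definition E_degree m : nat := Num.truncn (E_index rho k m).

Lemma E_termE alpha beta gamma x m : E_index rho k m \is a Num.nat ->
  E_term rho k alpha beta gamma x m = pochn alpha (E_degree m) * E_coef beta gamma x m.
Proof. by move=> idx; rewrite /E_term /pochhammer idx -mulrA. Qed.

(** If no i lies below k then rho is arbitrary, but its coefficient is 0. *)
Lemma E_degreeE m : (forall m, E_index rho k m \is a Num.nat) ->
  E_degree m = (Num.truncn rho * (\sum_(i < r | (i < k)%N) m i)
                + \sum_(i < r | (k <= i)%N) m i)%N.
Proof.
move=> nat_idx; apply/eqP; rewrite -(eqr_nat R) truncnK // natrD natrM /E_index.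
have [i0 /= ik|no] := pickP [pred i : 'I_r | (i < k)%N].
  by rewrite truncnK // (rho_nat ik).
by rewrite (big_pred0 _ _ _ _ no) !mulr0.
Qed.

(** This is the passage from x to y: the factors of the variables combine into the
power of w whose exponent is the degree. *)
Lemma E_coef_scale beta gamma x w m : (forall m, E_index rho k m \is a Num.nat) ->
  E_coef beta gamma
    (fun i => x i * (if (i < k)%N then w ^+ Num.truncn rho else w)) m
  = w ^+ E_degree m * E_coef beta gamma x m.
Proof.
move=> nat_idx; rewrite /E_coef mulrCA; congr (_ * _).
under eq_bigr do rewrite exprMn mulrAC.
rewrite big_split /= mulrC; congr (_ * _).
rewrite E_degreeE // exprD exprM !expr_sum (bigID (fun i : 'I_r => (i < k)%N)) /=.
congr (_ * _); first by apply: eq_bigr => i ->.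
by apply: eq_big => i; [rewrite -leqNgt|move=> /negbTE ->].
Qed.

End HypergeometricTerms.

(** * The generating function *)

Unset Implicit Arguments.
Set Strict Implicit.

Theorem theorem2 (R : realType) (r k : nat) (hr : (1 <= r)%N) (hk : (k <= r)%N)
    (rho : R) (hrho : 0 <= rho)
    (lambda t : R[i]) (ht : `|t| < 1)
    (beta gamma x : 'I_r -> R[i]) :
  let y := fun i : 'I_r =>
    if (i < k)%N then x i * cpow (- t) rho%:C / cpow (1 - t) rho%:C
    else - x i * t / (1 - t) in
  let a := fun n : nat =>
    pochn lambda n / n`!%:R * E rho k (- n%:R) beta gamma x * t ^+ n in
  (forall n : nat, E_defined rho k (- n%:R) beta gamma x) ->
  E_defined rho k lambda beta gamma y ->
  cvgn (series a : nat -> R[i]^o) ->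
  limn (series a : nat -> R[i]^o)
  = cpow (1 - t) (- lambda) * E rho k lambda beta gamma y.
Proof.
move=> y a defx defy cvga.
have t1 : Normc.normc t < 1 by rewrite -ltcR; exact: ht.
have nat_idx := E_defined_index_nat (defx 0%N).
have yE : y = (fun i => x i * (if (i < k)%N then euler_map t ^+ Num.truncn rho
                               else euler_map t)).
  apply/funext => i; rewrite /y; case: ifP => ik; last first.
    by rewrite /euler_map mulNr mulrA mulrN.
  rewrite -[rho in LHS](truncnK (rho_nat ik nat_idx)) !cpow_nat.
  by rewrite /euler_map expr_div_n mulrA.
have sumx n : has_sum (fun m => pochn (- n%:R) (E_degree rho k m) * E_coef k beta gamma x m)
    (E rho k (- n%:R) beta gamma x).
  have := cvg_partial_sum_has_sum (E_defined_convergent (defx n)).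
  by congr has_sum; apply/funext => m; rewrite E_termE.
have sumy : has_sum (fun m => pochn lambda (E_degree rho k m) *
      euler_map t ^+ E_degree rho k m * E_coef k beta gamma x m)
    (E rho k lambda beta gamma y).
  have := cvg_partial_sum_has_sum (E_defined_convergent defy).
  congr has_sum; apply/funext => m; rewrite E_termE // -mulrA -E_coef_scale //.
  by rewrite -yE.
(* The weight (-N)_N is nonzero, and the series for n = N is convergent. *)
have [|N|d dP] := @has_sum_group R _ (@E_degree R rho k r) (E_coef k beta gamma x)
  (fun n N => pochn (- n%:R) N).
- move=> N; rewrite pochn_opp_nat // subnn fact0 divr1.
  by rewrite mulf_neq0 ?signr_eq0 // pnatr_eq0 -lt0n fact_gt0.
- exact: has_sum_abs_summable (sumx N).
have aE : a = (fun n => euler_coef lambda (fun N => pochn lambda N * d N) n * t ^+ n).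
  apply/funext => n; rewrite /a euler_coef_pochn; congr (_ * _ * _).
  apply: has_sum_unique (dP _ _ (sumx n)) _.
  by apply: has_sum_nat_finite => N nN; rewrite pochn_opp_nat_eq0 ?mul0r.
rewrite -binomial_sum_cpow //.
apply: (@euler_summation R lambda (fun N => pochn lambda N * d N)) => //.
  by rewrite -aE; exact: cvgn_series_to.
have := dP (fun N => pochn lambda N * euler_map t ^+ N) _ sumy.
by congr has_sum; apply/funext => N; rewrite mulrAC.
Qed.
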